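(* Fix a constant number $k$ of knapsack constraints and a parameter $0<\epsilon<1/(4k^2)$. There is a randomized algorithm, running in polynomial time for fixed $k$ and $\epsilon$, which, given a finite ground set $X$, non-negative weights $c_{ij}$ ($i\in X$, $1\le j\le k$) with all knapsack capacities equal to $1$, and a non-negative (not necessarily monotone) submodular function $f\colon 2^X\to\mathbb{R}_+$ accessed through a value oracle, returns a packable set $D\subseteq X$ (i.e. $\sum_{i\in D}c_{ij}\le 1$ for all $j=1,\dots,k$) whose expected value satisfies $\mathbf{E}[f(D)]\ge (0.25-2\epsilon)\,OPT$, where $OPT=\max\{f(S)\colon S\subseteq X \text{ packable}\}$.
   Context: A function $f\colon 2^X\to\mathbb{R}_+$ is submodular if $f(A)+f(B)\ge f(A\cap B)+f(A\cup B)$ for all $A,B\subseteq X$. Given weight vectors $c_{\cdot j}$ and capacities $C_j$ for $j=1,\dots,k$, a set $V\subseteq X$ is packable if $\sum_{i\in V}c_{ij}\le C_j$ for every $j$; here the capacities are normalized to $C_j=1$. *)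

(* Defs.v *)
(* Mathematical Components, with R : realType from MathComp-Analysis.         *)
From HB Require Import structures.
From mathcomp Require Import all_boot all_order all_algebra.
From mathcomp Require Import reals.

Set Implicit Arguments.
Unset Strict Implicit.
Unset Printing Implicit Defensive.

Import Order.TTheory GRing.Theory Num.Theory.

Local Open Scope ring_scope.

Section Problem.
Variables (R : realType) (X : finType).

Definition submodular (f : {set X} -> R) : Prop :=
  forall A B : {set X}, f (A :&: B) + f (A :|: B) <= f A + f B.

Definition packable (k : nat) (c : X -> 'I_k -> R) (C : 'I_k -> R)
    (V : {set X}) : bool :=
  [forall j, \sum_(i in V) c i j <= C j].

(* The default value f set0 makes this the true maximum: set0 is packable     *)
(* as soon as the capacities are non-negative.                                *)
Definition OPT (k : nat) (c : X -> 'I_k -> R) (C : 'I_k -> R)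
    (f : {set X} -> R) : R :=
  \big[Num.max/f set0]_(S : {set X} | packable c C S) f S.

End Problem.

(* Model of computation: a probabilistic real RAM with a value oracle.        *)
(* Programs are finite syntax trees that do not depend on the instance.       *)
(* Their memory consists of index arrays (with cells in nat) and real arrays  *)
(* (with cells in R); the name of an array is a constant of the program, and  *)
(* a scalar variable is a cell of an array. Each elementary instruction, each *)
(* test and each oracle call costs one step. To keep the unit cost honest,    *)
(* indices only support addition and truncated subtraction, and there is no   *)
(* rounding from reals to indices.                                            *)

Inductive iexp : Type :=
  | INat of nat
  | IGet of nat & iexp        (* array name, index *)
  | IAdd of iexp & iexp
  | ISub of iexp & iexp.

Inductive rexp : Type :=
  | RNat of iexp
  | RGet of nat & iexp        (* array name, index *)
  | RAdd of rexp & rexp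
  | RSub of rexp & rexp
  | RMul of rexp & rexp
  | RDiv of rexp & rexp.

Inductive bexp : Type :=
  | BILe of iexp & iexp
  | BRLe of rexp & rexp
  | BNot of bexp
  | BAnd of bexp & bexp.

Inductive cmd : Type :=
  | CSkip
  | CISet of nat & iexp & iexp   (* index array [ index ] := value *)
  | CRSet of nat & iexp & rexp   (* real array [ index ] := value *)
  | CFlip of nat & iexp          (* index array [ index ] := fair coin *)
  | CQuery of nat & iexp & nat   (* real array [ index ] := f (set coded by
                                    the index array given last) *)
  | CSeq of cmd & cmd
  | CIf of bexp & cmd & cmd
  | CWhile of bexp & cmd.

Definition upd (T : Type) (m : nat -> nat -> T) (a i : nat) (v : T) :
    nat -> nat -> T :=
  fun a' i' => if (a' == a) && (i' == i) then v else m a' i'.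

Section Semantics.
Variable R : realType.

Record state : Type :=
  State { imem : nat -> nat -> nat; rmem : nat -> nat -> R }.

Fixpoint ieval (s : state) (e : iexp) : nat :=
  match e with
  | INat n => n
  | IGet a i => imem s a (ieval s i)
  | IAdd e1 e2 => (ieval s e1 + ieval s e2)%N
  | ISub e1 e2 => (ieval s e1 - ieval s e2)%N
  end.

(* Division by zero returns zero, as in the ring R.                           *)
Fixpoint reval (s : state) (e : rexp) : R :=
  match e with
  | RNat e1 => (ieval s e1)%:R
  | RGet a i => rmem s a (ieval s i)
  | RAdd e1 e2 => reval s e1 + reval s e2
  | RSub e1 e2 => reval s e1 - reval s e2
  | RMul e1 e2 => reval s e1 * reval s e2
  | RDiv e1 e2 => reval s e1 / reval s e2
  end.

Fixpoint beval (s : state) (e : bexp) : bool :=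
  match e with
  | BILe e1 e2 => (ieval s e1 <= ieval s e2)%N
  | BRLe e1 e2 => reval s e1 <= reval s e2
  | BNot e1 => ~~ beval s e1
  | BAnd e1 e2 => beval s e1 && beval s e2
  end.

Variable X : finType.

(* Elements of X are numbered from 0 to #|X| - 1 by enum_rank; an index array *)
(* codes the set of the elements whose cell is nonzero.                       *)
Definition coded_set (s : state) (a : nat) : {set X} :=
  [set x : X | imem s a (enum_rank x) != 0%N].

(* A configuration is the stack of the commands still to be executed together *)
(* with the memory. As for a probabilistic Turing machine, one fresh coin is  *)
(* tossed at each step; only CFlip looks at it.                               *)
Definition config : Type := (seq cmd * state)%type.

Definition step (f : {set X} -> R) (coin : bool) (cf : config) : config :=
  let: (K, s) := cf in
  match K with
  | [::] => cf
  | CSkip :: K' => (K', s)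
  | CISet a i e :: K' =>
      (K', State (upd (imem s) a (ieval s i) (ieval s e)) (rmem s))
  | CRSet a i e :: K' =>
      (K', State (imem s) (upd (rmem s) a (ieval s i) (reval s e)))
  | CFlip a i :: K' =>
      (K', State (upd (imem s) a (ieval s i) (nat_of_bool coin)) (rmem s))
  | CQuery a i b :: K' =>
      (K', State (imem s) (upd (rmem s) a (ieval s i) (f (coded_set s b))))
  | CSeq P Q :: K' => (P :: Q :: K', s)
  | CIf t P Q :: K' => ((if beval s t then P else Q) :: K', s)
  | CWhile t P :: K' => (if beval s t then P :: K else K', s)
  end.

(* The input: #|X| in cell 0 of the index array 0, and c i j in cell          *)
(* enum_rank i of the real array j. All the other cells are zero.             *)
Definition input (k : nat) (c : X -> 'I_k -> R) : state :=
  State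
    (fun a i => if (a == 0%N) && (i == 0%N) then #|X| else 0%N)
    (fun a i =>
       match insub a : option 'I_k, insub i : option 'I_#|X| with
       | Some j, Some r => c (enum_val r) j
       | _, _ => 0
       end).

(* The configuration reached after size w steps on the coin tosses w.         *)
Definition run (f : {set X} -> R) (k : nat) (c : X -> 'I_k -> R) (P : cmd)
    (w : seq bool) : config :=
  foldl (fun cf coin => step f coin cf) ([:: P], input c) w.

Definition halted (cf : config) : bool := nilp cf.1.

(* The returned set is the one coded by the index array 1.                    *)
Definition output (cf : config) : {set X} := coded_set cf.2 1.

(* Expectation over T independent fair coin tosses.                           *)
Definition coin_expectation (T : nat) (Z : T.-tuple bool -> R) : R :=
  (\sum_(w : T.-tuple bool) Z w) / 2 ^+ T.

End Semantics.

(* Main.v *)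
Require Import Defs.
From mathcomp Require Import all_boot all_order all_algebra.
From mathcomp Require Import reals.
From mathcomp Require Import sequences exp.
From mathcomp Require Import ring lra zify.

Set Implicit Arguments.
Unset Strict Implicit.
Unset Printing Implicit Defensive.

Import Order.TTheory GRing.Theory Num.Theory.

Local Open Scope ring_scope.

(* A discrete measured greedy. Guess a core A of at most L elements inside an *)
(* optimal set O, chosen greedily by marginal value: the elements of O that   *)
(* are large for the capacities left by A are boundedly many and each has a   *)
(* marginal value at most f A / L, so dropping them loses at most f O / 64.   *)
(* Starting from S = A, run N/2 rounds; each round draws r uniformly among    *)
(* N = 2^m numbers and adds the element r if it lies in M(S). Here            *)
(* w_j(S) = prod_(i in S - A) (1 + lam c_ij / cap_j) is the price of the      *)
(* resource j, and M(S) is the density-greedy solution of the single knapsack *)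
(* sum_j w_j c_j / cap_j <= sum_j w_j, for which O is feasible. Hence         *)
(*   E f(S + r) - f S >= (f(S u O) - f S) / N,                                *)
(*   E f((S + r) u O) >= (1 - 1/N) f(S u O),                                  *)
(*   E sum_j w_j(S + r) <= (1 + (lam + 1/2) / N) sum_j w_j(S).                *)
(* The first two give (N/2) (1/N) (1 - 1/N)^(N/2 - 1) >= 9/32 of f O. An      *)
(* element that does not fit is skipped; at such a moment the prices exceed   *)
(* exp(2 lam / 3), while they start at k and grow in expectation at most by   *)
(* exp(lam / 2 + 1/4), so with lam = 768 k overflows cost at most 1/64 of     *)
(* f O. What remains is at least f O / 4, for constants depending only on k.  *)

(** * Density-greedy solution of a knapsack *)

(** Fix an optimal packable set [O]. The theorem combines a statement about a random process on sets
    with a statement about the program.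

    The k knapsacks are then replaced by a single one, with prices growing exponentially in the use
    of each resource. There the density greedy is worth at least as much as any feasible set
    ([greedy_value]) and exceeds the budget by at most one item ([greedy_cost]). A potential linear
    in [f S], [f (S :|: O)] and the total price turns the resulting one-round estimates into a lower
    bound on the expectation [value] ([potential_step], [potential_le_value]). Its price term pays
    for elements that do not fit ([total_wgt_overflow], [potential_overflow]). [value_ge_quarter]
    evaluates the constants.

    The program runs the process from every possible core and keeps the best set found. The
    predicates [good] and [wp] treat halting time, packability and expectation together: a promised
    value is carried along the execution and split at each coin. In [wp_all_guesses] the promise of
    the right core crosses the other iterations intact, because the stored value never decreases.
    [good_sound] turns the final promise into a bound on the expectation, and [cost_poly] makes the
    time bound a polynomial. *)

Section GreedyKnapsack.
Variables (R : realType) (X : finType) (P : pred X) (v w : X -> R) (W : R).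

(** Densities [v / w] are compared after cross-multiplication, so that zero costs need no separate
    case; ranks break ties. *)
Definition denser (y x : X) : bool :=
  (v x * w y < v y * w x)
  || ((v x * w y <= v y * w x) && (enum_rank y < enum_rank x)%N).

Definition cost_before (x : X) : R :=
  \sum_(y | [&& P y, 0 < v y & denser y x]) w y.

(** Only what precedes [x] is charged, so the element that crosses the budget is still taken.
    Membership of a single element can be tested without sorting. *)
Definition greedy (x : X) : bool := [&& P x, 0 < v x & cost_before x < W].

Hypothesis w_ge0 : forall x, P x -> 0 <= w x.
Hypothesis W_gt0 : 0 < W.

Let pos x := P x && (0 < v x).
Let before x := [set y | pos y && denser y x].

Lemma denser_irr x : denser x x = false.
Proof. by rewrite /denser ltxx ltnn andbF. Qed.

Lemma denser_total x y : x != y -> denser x y || denser y x.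
Proof.
move=> xy; have rxy : enum_rank x != enum_rank y by rewrite (inj_eq enum_rank_inj).
rewrite /denser; case: (ltgtP (v x * w y) (v y * w x)) => //= e.
by have := rxy; rewrite -val_eqE /= neq_ltn => /orP[] ->; rewrite ?orbT.
Qed.

Lemma denser_trans x y z : pos x -> pos y -> pos z ->
  denser x y -> denser y z -> denser x z.
Proof.
move=> /andP[Px vx] /andP[Py vy] /andP[Pz vz].
have wx := w_ge0 Px; have wy := w_ge0 Py; have wz := w_ge0 Pz.
have le_lt a b c : 0 < v a -> 0 < v b -> 0 < v c -> 0 <= w a -> 0 <= w b -> 0 <= w c ->
  v b * w a <= v a * w b -> v c * w b <= v b * w c -> v c * w a <= v a * w c.
  move=> va vb vc wa wb wc h1 h2; rewrite -(ler_pM2l vb).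
  have := ler_wpM2l (ltW vc) h1; have := ler_wpM2l (ltW va) h2; lra.
move=> h1 h2.
have l1 : v y * w x <= v x * w y by case/orP: h1 => [/ltW//|/andP[]].
have l2 : v z * w y <= v y * w z by case/orP: h2 => [/ltW//|/andP[]].
have l3 := le_lt _ _ _ vx vy vz wx wy wz l1 l2.
rewrite /denser l3 /=; case: ltP => //= l4.
(* If [x] and [z] tie, both intermediate comparisons are ties as well, and the ranks decide. *)
have e1 : v x * w y <= v y * w x.
  rewrite -(ler_pM2l vz).
  have := ler_wpM2l (ltW vx) l2; have := ler_wpM2l (ltW vy) l4; lra.
have e2 : v y * w z <= v z * w y.
  rewrite -(ler_pM2l vx).
  have := ler_wpM2l (ltW vz) l1; have := ler_wpM2l (ltW vy) l4; lra.
move: h1 h2; rewrite /denser !ltNge e1 e2 /= => /andP[_ r1] /andP[_ r2].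
exact: ltn_trans r1 r2.
Qed.

Let costE x : cost_before x = \sum_(y in before x) w y.
Proof. by apply: eq_bigl => y; rewrite inE /pos andbA. Qed.

Let before_sub x y : pos x -> pos y -> denser x y -> x |: before x \subset before y.
Proof.
move=> px py xy; apply/subsetP=> z; rewrite !inE => /orP[/eqP->|/andP[pz zx]].
  by rewrite px xy.
by rewrite pz /=; apply: denser_trans zx xy.
Qed.

Let before_card x y : pos x -> pos y -> denser x y -> (#|before x| < #|before y|)%N.
Proof.
move=> px py xy; have := subset_leq_card (before_sub px py xy).
by rewrite cardsU1 inE denser_irr andbF.
Qed.

Let greedy_pos x : greedy x -> pos x.
Proof. by case/and3P=> p q _; rewrite /pos p q. Qed.

Let sum_before (x : X) (B : {set X}) : B \subset before x ->
  \sum_(y in B) w y <= cost_before x.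
Proof.
move=> sB; rewrite costE [leRHS](big_setID B) /= (setIidPr sB) lerDl.
apply: sumr_ge0 => y; rewrite !inE => /andP[_ /andP[/andP[Py _] _]].
exact: w_ge0.
Qed.

(** All chosen elements precede the one with the most predecessors, so together they cost less than
    [W]; that last one adds at most [D]. *)
Lemma greedy_cost (D : R) : 0 <= D -> (forall x, P x -> w x <= D) ->
  \sum_(x | greedy x) w x <= W + D.
Proof.
move=> D0 wD; case: (pickP greedy) => [x0 gx0|g0]; last first.
  by rewrite big_pred0 //; rewrite addr_ge0 // ltW.
case: (arg_maxnP (fun x => #|before x|) gx0) => x gx xmax.
have px := greedy_pos gx.
rewrite (bigD1 x) //= addrC; apply: lerD; last by apply: wD; case/andP: px.
have /and3P[_ _ /ltW] := gx; apply: le_trans.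
rewrite (eq_bigl [in [set y | greedy y && (y != x)]]); last by move=> y; rewrite inE.
apply: sum_before; apply/subsetP => y; rewrite !inE => /andP[gy yx].
have py := greedy_pos gy; rewrite py /=.
have /orP[//|xy] := denser_total yx.
by have := leq_trans (before_card px py xy) (xmax _ gy); rewrite ltnn.
Qed.

(** Exchange argument at the first rejected element [r] of positive value: the chosen elements are
    exactly the positive ones denser than [r], and they cost at least [W], hence at least as much as
    [O]. *)
Lemma greedy_value (O : {set X}) : (forall x, x \in O -> P x) ->
  \sum_(x in O) w x <= W -> \sum_(x in O) v x <= \sum_(x | greedy x) v x.
Proof.
move=> OP OW; case: (pickP (fun x => pos x && ~~ greedy x)) => [r0 pr0|g0]; last first.
  rewrite big_mkcond [leRHS]big_mkcond; apply: ler_sum => x _.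
  have := g0 x; case: ifP => [xO|_]; last first.
    by case: ifP => // /and3P[_ /ltW].
  rewrite /pos (OP x xO) /=; case: ltP => //= vx; first by move/negbFE => ->.
  by case: ifP => // /and3P[_ +  _]; rewrite ltNge vx.
case: (@arg_minnP _ r0 (fun x => pos x && ~~ greedy x) (fun x => #|before x|) pr0) => r /andP[pr ngr] rmin.
have /andP[Pr vr] := pr.
have gE y : pos y -> greedy y = denser y r.
  move=> py; apply/idP/idP => [gy|yr].
    have yr : y != r by apply: contraNneq ngr => <-.
    have /orP[//|ry] := denser_total yr.
    case/negP: ngr; rewrite /greedy Pr vr /=; have /and3P[_ _] := gy.
    apply: le_lt_trans; rewrite costE; apply: sum_before.
    by apply: subset_trans (before_sub pr py ry); apply: subsetUr.
  apply: contraT => ngy; have := rmin y; rewrite py ngy => /(_ isT).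
  by rewrite leqNgt before_card.
have costr : W <= cost_before r.
  by rewrite leNgt; apply: contra ngr => h; rewrite /greedy Pr vr.
(* If [r] cost nothing, everything denser would cost nothing either, and [W <= cost_before r] would
   fail. *)
have wr : 0 < w r.
  rewrite lt_neqAle w_ge0 // andbT; apply/eqP => wr0.
  move: costr; rewrite costE big1 ?leNgt ?W_gt0 // => y.
  rewrite inE => /andP[/andP[Py vy] yr].
  have : v r * w y <= v y * w r by case/orP: yr => [/ltW//|/andP[]].
  rewrite -wr0 mulr0 pmulr_rle0 // => h; apply/eqP; rewrite eq_le h.
  by rewrite w_ge0.
have key : 0 <= \sum_y ((greedy y)%:R - (y \in O)%:R) * (v y * w r - v r * w y).
  apply: sumr_ge0 => y _; case: (boolP (greedy y)) => gy.
    have py := greedy_pos gy; have := gy; rewrite gE // => yr.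
    apply: mulr_ge0; first by case: (y \in O); rewrite /= ?subrr ?subr0.
    by rewrite subr_ge0; case/orP: yr => [/ltW//|/andP[]].
  case: (boolP (y \in O)) => yO; last by rewrite subrr mul0r.
  rewrite sub0r mulN1r oppr_ge0 subr_le0.
  have Py := OP _ yO; case: (ltP 0 (v y)) => vy.
    have py : pos y by rewrite /pos Py vy.
    move: gy; rewrite gE // => /negP ny; rewrite leNgt; apply/negP => h.
    by apply: ny; rewrite /denser h.
  by apply: le_trans (_ : 0 <= _); rewrite ?mulr_le0_ge0 ?mulr_ge0 ?w_ge0 // ltW.
have splitE (F : X -> R) :
    \sum_y ((greedy y)%:R - (y \in O)%:R) * F y
    = \sum_(y | greedy y) F y - \sum_(y in O) F y.
  rewrite [in RHS]big_mkcond [X in _ - X]big_mkcond -sumrB; apply: eq_bigr => y _.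
  by rewrite mulrBl; congr (_ - _); case: ifP => _; rewrite ?mul1r ?mul0r.
have gw : W <= \sum_(y | greedy y) w y.
  apply: le_trans costr _; rewrite costE le_eqVlt; apply/orP; left; apply/eqP.
  apply: eq_bigl => y; rewrite inE; case: (boolP (pos y)) => py /=.
    by rewrite gE.
  by apply/esym/negbTE; apply: contra py => /greedy_pos.
move: key; rewrite splitE !sumrB -!mulr_suml -!mulr_sumr.
set gv := \sum_(y | greedy y) v y; set ov := \sum_(y in O) v y.
move: gw OW; set gw := \sum_(y | greedy y) w y; set ow := \sum_(y in O) w y.
move=> h1 h2 h3; rewrite -(ler_pM2r wr).
have := ler_wpM2l (ltW vr) (le_trans h2 h1); lra.
Qed.

End GreedyKnapsack.

(** * Rounds of the measured greedy *)

Section Submodular.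
Variables (R : realType) (X : finType) (f : {set X} -> R).

Definition marg (S : {set X}) (x : X) : R := f (x |: S) - f S.

Hypotheses (f_ge0 : forall A, 0 <= f A) (f_sub : submodular f).

Lemma marg_in (S : {set X}) x : x \in S -> marg S x = 0.
Proof. by move=> xS; rewrite /marg (setUidPr _) ?subrr // sub1set. Qed.

Lemma marg_anti (S T : {set X}) x : S \subset T -> x \notin T -> marg T x <= marg S x.
Proof.
move=> ST xT; have := f_sub (x |: S) T.
have -> : (x |: S) :&: T = S.
  apply/setP=> y; rewrite !inE; case: eqP => [->|_] /=.
    by rewrite (negPf xT); apply/esym/negbTE; apply: contra xT => /(subsetP ST).
  by apply/andP/idP => [[]//|yS]; split=> //; apply: (subsetP ST).
rewrite -setUA (setUidPr ST) /marg; lra.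
Qed.

(** The elements of [M] are added one by one, each with a marginal no larger than at [S]. *)
Lemma submodular_union (S M : {set X}) :
  f (S :|: M) - f S <= \sum_(x in M) marg S x.
Proof.
rewrite -big_enum /= -{1}(set_enum M); have := enum_uniq (mem M).
elim: (enum M) => [|x s IH] /=.
  by rewrite big_nil (_ : [set x in [::]] = set0) ?setU0 ?subrr //; apply/setP=> y; rewrite !inE.
case/andP=> xs us; rewrite big_cons; have := IH us.
set T := [set y in s]; have -> : [set y in x :: s] = x |: T by apply/setP=> y; rewrite !inE.
rewrite setUCA; case: (boolP (x \in S)) => xS.
  have -> : x |: (S :|: T) = S :|: T by apply/setUidPr; rewrite sub1set inE xS.
  by rewrite marg_in ?add0r.
have := @marg_anti S (S :|: T) x (subsetUl _ _); rewrite !inE (negPf xS) (negPf xs) /=.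
move=> /(_ isT); rewrite {1}/marg; lra.
Qed.

Lemma submodular_remove (A O B : {set X}) : A \subset O :\: B -> B \subset O ->
  f O - f (O :\: B) <= \sum_(x in B) marg A x.
Proof.
move=> AO BO; have := submodular_union (O :\: B) B.
rewrite setUC -{1}(setIidPr BO) setID => /le_trans; apply.
apply: ler_sum => x xB; apply: marg_anti => //; by rewrite inE xB.
Qed.

Lemma subadditive (S T : {set X}) : f (S :|: T) <= f S + f T.
Proof. by have := f_sub S T; have := f_ge0 (S :&: T); lra. Qed.

(** Pick elements of [O] by largest marginal. By submodularity each of the [L] increments is at
    least the marginal of any element still left; if [O] runs out earlier, nothing is left to
    bound. *)
Lemma core_guess (L : nat) (O : {set X}) : exists s : seq X,
  [/\ (size s <= L)%N, {subset s <= O} &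
   forall x, x \in O -> x \notin s -> L%:R * marg [set y in s] x <= f [set y in s]].
Proof.
(* Relative to [f set0] the value of the core is the telescoping sum of its increments, which is
   what the induction needs. *)
suff [s [sL sO H]] : exists s : seq X,
  [/\ (size s <= L)%N, {subset s <= O} & forall x, x \in O -> x \notin s ->
   L%:R * marg [set y in s] x <= f [set y in s] - f set0].
  exists s; split=> // x xO xs; apply: le_trans (H x xO xs) _.
  by rewrite gerBl.
elim: L => [|L [s [sL sO H]]].
  have set_nil : [set y in [::]] = set0 :> {set X} by apply/setP=> y; rewrite !inE.
  by exists [::]; split=> // x _ _; rewrite mul0r set_nil subrr.
case: (pickP (fun x => (x \in O) && (x \notin s))) => [x0 px0|none]; last first.
  by exists s; split=> [||x xO xs]; rewrite ?leqW //; have := none x; rewrite xO xs.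
have := @arg_maxP _ R X x0 (fun x => (x \in O) && (x \notin s)) (marg [set y in s]) px0.
case=> x /andP[xO xs] xmax; exists (x :: s); split=> // [y|y yO].
  by rewrite inE => /orP[/eqP->//|/sO].
rewrite inE negb_or => /andP[yx ys].
have -> : [set y in x :: s] = x |: [set y in s] by apply/setP=> z; rewrite !inE.
have h1 := H x xO xs.
have h2 : marg [set y in s] y <= marg [set y in s] x by apply: xmax; rewrite yO ys.
have h3 : marg (x |: [set y in s]) y <= marg [set y in s] y.
  by apply: marg_anti; [apply: subsetUr | rewrite !inE negb_or yx].
have h4 : L.+1%:R * marg (x |: [set y in s]) y <= L.+1%:R * marg [set y in s] x.
  by rewrite ler_pM2l ?ltr0n //; apply: le_trans h3 h2.
apply: le_trans h4 _; rewrite -natr1 mulrDl mul1r {2}/marg; lra.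
Qed.

End Submodular.

(** * Prices and the greedy choice above a fixed core *)

Section Residual.
Variables (R : realType) (X : finType) (f : {set X} -> R).
Variables (k : nat) (c : X -> 'I_k -> R) (l lam : nat) (A : {set X}).

Definition cap (j : 'I_k) : R := 1 - \sum_(i in A) c i j.
(** When the core exhausts resource [j], division by zero makes the share zero. For positive [l]
    this is harmless: a small element then has no weight in [j]. *)
Definition share (x : X) (j : 'I_k) : R := c x j / cap j.
Definition small (x : X) : bool := [forall j, c x j * l%:R <= cap j].
Definition wgt (S : {set X}) (j : 'I_k) : R :=
  \prod_(i in S :\: A) (1 + lam%:R * share i j).
Definition total_wgt (S : {set X}) : R := \sum_j wgt S j.
Definition wcost (S : {set X}) (x : X) : R := \sum_j wgt S j * share x j.
Definition cand (S : {set X}) (x : X) : bool := (x \notin S) && small x.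
Definition chosen (S : {set X}) (x : X) : bool :=
  greedy (cand S) (marg f S) (wcost S) (total_wgt S) x.
Definition add_if_chosen (S : {set X}) (x : X) : {set X} :=
  if chosen S x && packable c (fun=> 1) (x |: S) then x |: S else S.
Definition after_draw (S : {set X}) (r : nat) : {set X} :=
  if insub r is Some o then add_if_chosen S (enum_val (o : 'I_#|X|)) else S.

(** Expected final value with [i] rounds to go, defined by conditioning on the next draw. *)
Fixpoint value (N i : nat) (S : {set X}) : R :=
  if i is i'.+1 then (\sum_(r < N) value N i' (after_draw S r)) / N%:R else f S.

Hypotheses (c_ge0 : forall i j, 0 <= c i j).
Hypotheses (f_ge0 : forall A, 0 <= f A) (f_sub : submodular f).
Hypotheses (k_gt0 : (0 < k)%N) (lam_gt0 : (0 < lam)%N) (l_lam : l = (2 * lam)%N).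
Hypothesis A_packable : packable c (fun=> 1) A.

(** Packability is left out because the potential is also evaluated at the set that a non-fitting
    element would produce. *)
Definition reachable (S : {set X}) : Prop :=
  A \subset S /\ {in S :\: A, forall x, small x}.

Lemma cap_ge0 j : 0 <= cap j.
Proof. by rewrite subr_ge0; apply: (forallP A_packable). Qed.

Lemma share_ge0 x j : 0 <= share x j.
Proof. by rewrite divr_ge0 ?cap_ge0. Qed.

Let l_ge1 : 1 <= l%:R :> R.
Proof. by rewrite ler1n; lia. Qed.

Lemma share_small x j : small x -> share x j * l%:R <= 1.
Proof.
move=> /forallP/(_ j) h; rewrite /share mulrAC.
have := cap_ge0 j; rewrite le0r => /orP[/eqP->|cp]; first by rewrite invr0 mulr0.
by rewrite ler_pdivrMr ?mul1r.
Qed.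

Lemma wgt_gt0 S j : 0 < wgt S j.
Proof.
apply: prodr_gt0 => x _; apply: ltr_pwDl => //.
by rewrite mulr_ge0 ?share_ge0.
Qed.

Lemma total_wgt_gt0 S : 0 < total_wgt S.
Proof.
rewrite /total_wgt (bigD1 (Ordinal k_gt0)) //= ltr_pwDl ?wgt_gt0 //.
by apply: sumr_ge0 => j _; apply/ltW/wgt_gt0.
Qed.

Lemma wcost_ge0 S x : 0 <= wcost S x.
Proof. by apply: sumr_ge0 => j _; rewrite mulr_ge0 ?share_ge0 // ltW ?wgt_gt0. Qed.

Lemma total_wgt_init : total_wgt A = k%:R.
Proof.
rewrite /total_wgt (eq_bigr (fun=> 1)) ?sumr_const ?card_ord // => j _.
by rewrite /wgt setDv big_set0.
Qed.

Lemma wgt_add (S : {set X}) x j : A \subset S -> x \notin S ->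
  wgt (x |: S) j = wgt S j * (1 + lam%:R * share x j).
Proof.
move=> AS xS; have xA : x \notin A by apply: contra xS => /(subsetP AS).
rewrite /wgt; have -> : (x |: S) :\: A = x |: (S :\: A).
  by apply/setP=> y; rewrite !inE; case: eqP => // ->; rewrite xA.
by rewrite big_setU1 ?inE ?(negPf xS) ?andbF //= mulrC.
Qed.

Lemma total_wgt_add (S : {set X}) x : A \subset S -> x \notin S ->
  total_wgt (x |: S) = total_wgt S + lam%:R * wcost S x.
Proof.
move=> AS xS; rewrite /total_wgt /wcost mulr_sumr -big_split /=.
by apply: eq_bigr => j _; rewrite wgt_add //; ring.
Qed.

Lemma wcost_small S x : small x -> wcost S x <= total_wgt S / l%:R.
Proof.
move=> sx; rewrite ler_pdivlMr ?(lt_le_trans ltr01) // mulr_suml.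
apply: ler_sum => j _; rewrite -mulrA ler_piMr ?share_small // ltW //.
exact: wgt_gt0.
Qed.

(** From [exp(-t) >= 1 - t] with [t = 2y/3], since [(1 + y)(1 - 2y/3) >= 1] for [y] in [[0, 1/2]].
    The choice [l = 2 lam] keeps [lam * share] in this range. *)
Lemma expR_two_thirds (y : R) : 0 <= y -> y <= 1 / 2 -> expR (2 / 3 * y) <= 1 + y.
Proof.
move=> y0 y2; have h := expR_ge1Dx (- (2 / 3 * y)).
have e : expR (2 / 3 * y) * expR (- (2 / 3 * y)) = 1 by rewrite -expRD subrr expR0.
have p := expR_gt0 (2 / 3 * y).
have : expR (2 / 3 * y) * (1 + - (2 / 3 * y)) <= 1
  by apply: le_trans (ler_wpM2l (ltW p) h) _; rewrite e.
nra.
Qed.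

(** Where resource [j] overflows, the shares taken beyond the core sum to at least 1, and the
    product defining the price of [j] dominates the exponential of that sum. *)
Lemma total_wgt_overflow S : reachable S -> ~~ packable c (fun=> 1) S ->
  expR (2 / 3 * lam%:R) <= total_wgt S.
Proof.
case=> AS smS /forallPn[j]; rewrite -ltNge (big_setID A) /= (setIidPr AS) => h.
have h1 : cap j < \sum_(i in S :\: A) c i j by rewrite /cap ltrBlDl.
(* A resource exhausted by the core cannot overflow, as small elements do not use it. *)
have cp : 0 < cap j.
  rewrite lt_neqAle cap_ge0 andbT; apply: contraTneq h1 => c0; rewrite -leNgt -c0.
  apply: sumr_le0 => i /smS /forallP/(_ j); rewrite -c0 pmulr_lle0 //.
  exact: lt_le_trans ltr01 _.
have h2 : 1 <= \sum_(i in S :\: A) share i j.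
  by rewrite -mulr_suml ler_pdivlMr // mul1r ltW.
apply: (@le_trans _ _ (wgt S j)); last first.
  rewrite /total_wgt (bigD1 j) //= lerDl; apply: sumr_ge0 => i _.
  exact/ltW/wgt_gt0.
apply: (@le_trans _ _ (expR (\sum_(i in S :\: A) 2 / 3 * (lam%:R * share i j)))).
  by rewrite ler_expR -!mulr_sumr ler_pM2l ?divr_gt0 // ler_peMr.
rewrite expR_sum; apply: ler_prod => i iS; rewrite expR_ge0 /=.
apply: expR_two_thirds; first by rewrite mulr_ge0 ?share_ge0.
have := share_small j (smS i iS); rewrite l_lam natrM; lra.
Qed.

Lemma greedy_wcost S :
  \sum_(x | chosen S x) wcost S x <= total_wgt S * (1 + l%:R^-1).
Proof.
rewrite mulrDr mulr1; apply: greedy_cost => [x _|||x /andP[_]].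
- exact: wcost_ge0.
- exact: total_wgt_gt0.
- by rewrite mulr_ge0 ?invr_ge0 // ltW ?total_wgt_gt0.
- exact: wcost_small.
Qed.

(** In every resource the shares of [O :\: S] sum to at most 1, so [O :\: S] is feasible for the
    priced knapsack and the greedy set is worth at least as much. *)
Lemma greedy_marg (S O : {set X}) : A \subset S -> packable c (fun=> 1) O ->
  A \subset O -> {in O :\: A, forall x, small x} ->
  f (S :|: O) - f S <= \sum_(x | chosen S x) marg f S x.
Proof.
move=> AS pO AO smO.
have -> : S :|: O = S :|: (O :\: S).
  by apply/setP=> x; rewrite !inE; case: (x \in S).
apply: le_trans (submodular_union f_sub _ _) _.
apply: greedy_value => [x _|||].
- exact: wcost_ge0.
- exact: total_wgt_gt0.
- move=> x; rewrite /cand inE => /andP[xS xO]; rewrite xS smO // inE xO andbT.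
  by apply: contra xS => /(subsetP AS).
- rewrite /wcost exchange_big /=; apply: ler_sum => j _; rewrite -mulr_sumr.
  rewrite ler_piMr ?(ltW (wgt_gt0 _ _)) // /share -mulr_suml.
  have sub : \sum_(x in O :\: S) c x j <= cap j.
    rewrite /cap lerBrDl; apply: le_trans (forallP pO j).
    rewrite [leRHS](big_setID A) /= (setIidPr AO) lerD2l.
    rewrite big_mkcond [leRHS]big_mkcond; apply: ler_sum => x _; rewrite !inE.
    case: (x \in O); rewrite ?andbF // !andbT.
    case xS : (x \in S); case xA : (x \in A) => //=.
    by rewrite (subsetP AS) in xS.
  have := cap_ge0 j; rewrite le0r => /orP[/eqP->|cp]; first by rewrite invr0 mulr0.
  by rewrite ler_pdivrMr // mul1r.
Qed.

Lemma chosen_cand S x : chosen S x -> [/\ x \notin S, small x & 0 < marg f S x].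
Proof. by case/and3P=> /andP[]. Qed.

Lemma after_draw_cases S r : after_draw S r = S \/
  exists x, [/\ chosen S x, packable c (fun=> 1) (x |: S) & after_draw S r = x |: S].
Proof.
rewrite /after_draw; case: insubP => [o _ _|_]; last by left.
rewrite /add_if_chosen; case: ifP => [/andP[h1 h2]|_]; last by left.
by right; exists (enum_val o).
Qed.

Lemma reachable_add S x : reachable S -> small x -> reachable (x |: S).
Proof.
case=> AS sm sx; split; first by apply: subset_trans AS (subsetUr _ _).
move=> y; rewrite !inE => /andP[yA /orP[/eqP->//|yS]]; by apply: sm; rewrite inE yA.
Qed.

Lemma value_ge N i S : (0 < N)%N -> f S <= value N i S.
Proof.
move=> N0; elim: i S => [|i IH] S //=.
rewrite ler_pdivlMr ?ltr0n // mulr_natr -[X in _ *+ X](card_ord N) -sumr_const.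
apply: ler_sum => r _; apply: le_trans (IH _).
case: (after_draw_cases S r) => [->//|[x [/chosen_cand[_ _ h] _ ->]]].
by move: h; rewrite /marg subr_gt0 => /ltW.
Qed.

(** Draws below [#|X|] run through [X] once; the others leave [S] unchanged. *)
Lemma sum_after_draw (N : nat) (S : {set X}) (g : {set X} -> R) : (#|X| <= N)%N ->
  \sum_(r < N) g (after_draw S r) = N%:R * g S + \sum_x (g (add_if_chosen S x) - g S).
Proof.
move=> nN.
have -> : N%:R * g S = \sum_(r < N) g S by rewrite sumr_const card_ord mulr_natl.
apply/eqP; rewrite addrC -subr_eq -sumrB; apply/eqP.
rewrite (big_ord_widen _ (fun r => g (after_draw S r) - g S) (leqnn N)).
rewrite (bigID (fun r : 'I_N => (r < #|X|)%N)) /= addrC big1 ?add0r; last first.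
  by move=> r; rewrite ltn_ord /= /after_draw; case: insubP => [o ->//|_ _]; rewrite subrr.
under eq_bigl => r do rewrite ltn_ord /=.
rewrite -(big_ord_widen _ (fun r => g (after_draw S r) - g S) nN).
rewrite [RHS](reindex (@enum_val X X)) /=; last first.
  by apply: onW_bij; apply: enum_val_bij.
by apply: eq_bigr => r _; rewrite /after_draw valK.
Qed.

(** * Potential argument for the random process *)

Section Potential.
Variables (N : nat) (F : R) (O : {set X}).
Hypotheses (N_ge : (#|X| <= N)%N) (N_gt0 : (0 < N)%N).
Hypothesis F_max : forall B, packable c (fun=> 1) B -> f B <= F.
Hypotheses (O_packable : packable c (fun=> 1) O) (AO : A \subset O).
Hypothesis O_small : {in O :\: A, forall x, small x}.

Let dt : R := N%:R^-1.
Let growth : R := 1 + dt * (lam%:R * (1 + l%:R^-1)).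

(** These coefficients solve the backward recursion dictated by the one-round estimates for [f S],
    [f (S :|: O)] and the total price. *)
Definition coefS (i : nat) : R := (1 - dt) ^+ i.
Fixpoint coefO (i : nat) : R :=
  if i is i'.+1 then dt * coefS i' + (1 - dt) * coefO i' else 0.
(** Normalized so that the penalty is at least [2 * F] as soon as the total price reaches its
    overflow level. *)
Definition coefW (i : nat) : R := 2 * expR (- (2 / 3 * lam%:R)) * growth ^+ i.
(* What a reachable S guarantees with i rounds to go, by backward induction.  *)
Definition potential (i : nat) (S : {set X}) : R :=
  coefS i * f S + coefO i * f (S :|: O) - coefW i * total_wgt S * F.

Let dt_gt0 : 0 < dt. Proof. by rewrite invr_gt0 ltr0n. Qed.
Let dt_le1 : dt <= 1.
Proof. by rewrite invf_le1 ?ltr0n // ler1n. Qed.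
Let F_ge0 : 0 <= F.
Proof. exact: le_trans (f_ge0 A) (F_max A_packable). Qed.
Let growth_ge1 : 1 <= growth.
Proof. by rewrite lerDl !mulr_ge0 ?addr_ge0 ?invr_ge0 ?ler0n // ltW. Qed.

Lemma coefS_bounds i : 0 <= coefS i <= 1.
Proof.
by rewrite exprn_ge0 ?exprn_ile1 ?subr_ge0 // gerBl ltW.
Qed.

Lemma coefO_bounds i : 0 <= coefO i <= 1 - coefS i.
Proof.
elim: i => [|i /andP[h1 h2]]; first by rewrite /= /coefS expr0 subrr lexx.
have /andP[s1 s2] := coefS_bounds i; rewrite /= /coefS exprS -/(coefS i).
apply/andP; split; first by rewrite addr_ge0 ?mulr_ge0 ?subr_ge0 // ltW.
have q0 : 0 <= 1 - dt by rewrite subr_ge0.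
have := ler_wpM2l q0 h2; have := ler_wpM2l (ltW dt_gt0) s2; lra.
Qed.

Lemma coefO_closed i : coefO i.+1 = i.+1%:R * dt * (1 - dt) ^+ i.
Proof.
elim: i => [|i IH]; first by rewrite /= /coefS !expr0; ring.
rewrite [LHS]/= -/(coefO i.+1) IH /coefS exprS.
by rewrite -[i.+2%:R]natr1; ring.
Qed.

Lemma coefW_ge i : 2 * expR (- (2 / 3 * lam%:R)) <= coefW i.
Proof. by rewrite /coefW ler_peMr ?exprn_ege1 // mulr_ge0 ?expR_ge0. Qed.

(** A small element always fits next to the core alone, so already its marginal at [A] is at most
    [F]. *)
Lemma marg_le_max (S : {set X}) x : A \subset S -> x \notin S -> small x -> marg f S x <= F.
Proof.
move=> AS xS sx; have xA : x \notin A by apply: contra xS => /(subsetP AS).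
apply: le_trans (marg_anti f_sub AS xS) _; rewrite /marg lerBlDr.
rewrite -[leLHS]addr0 lerD ?F_max //; apply/forallP => j.
rewrite big_setU1 //= -lerBrDr; apply: le_trans (forallP sx j).
by rewrite ler_peMr.
Qed.

(** Skipping a non-fitting [x] is no worse than the potential predicts: [f (x |: S)] exceeds [f S]
    by at most [F], the union with [O] by at most [2 * F], the two coefficients sum to at most 1,
    and the penalty is at least [2 * F]. *)
Lemma potential_overflow i S x : reachable S -> chosen S x ->
  ~~ packable c (fun=> 1) (x |: S) -> potential i (x |: S) <= f S.
Proof.
move=> rS /chosen_cand[xS sx mx] np.
have ov := total_wgt_overflow (reachable_add rS sx) np.
have mF := marg_le_max rS.1 xS sx.
have h1 := subadditive f_ge0 f_sub (x |: S) O.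
have h2 := F_max O_packable.
have /andP[a0 a1] := coefS_bounds i; have /andP[b0 b1] := coefO_bounds i.
have hW : 2 <= coefW i * total_wgt (x |: S).
  apply: le_trans (_ : 2 * expR (- (2 / 3 * lam%:R)) * expR (2 / 3 * lam%:R) <= _).
    by rewrite -mulrA -expRD addNr expR0 mulr1.
  by apply: ler_pM; rewrite ?mulr_ge0 ?expR_ge0 ?coefW_ge.
have hWF := ler_wpM2r F_ge0 hW.
move: mF; rewrite /potential /marg => mF.
have f1 : f (x |: S) <= f S + F by lra.
have e1 := ler_wpM2l a0 f1.
have e2 : coefO i * f (x |: S :|: O) <= coefO i * (f S + F + F).
  by apply: ler_wpM2l => //; lra.
have e3 : (coefS i + coefO i) * (f S + F) <= 1 * (f S + F).
  by apply: ler_wpM2r; [rewrite addr_ge0 | lra].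
have e4 : coefO i * F <= 1 * F by apply: ler_wpM2r => //; lra.
lra.
Qed.

(** The three one-round estimates are combined with non-negative coefficients; the recursions for
    the coefficients make the remaining comparison an identity. *)
Lemma potential_step i S : reachable S ->
  potential i.+1 S <=
  potential i S + dt * \sum_(x | chosen S x) (potential i (x |: S) - potential i S).
Proof.
move=> rS; have [AS smS] := rS.
have g1 := greedy_marg AS O_packable AO O_small.
have g2 := greedy_wcost S.
have /andP[a0 a1] := coefS_bounds i; have /andP[b0 b1] := coefO_bounds i.
have w0 : 0 <= coefW i by apply: le_trans (coefW_ge i); rewrite mulr_ge0 ?expR_ge0.
set M := [set x | chosen S x].
(* Adding all of [M] to [S :|: O] leaves a non-negative value, so the marginals lose at most
   [f (S :|: O)] in total, and one random draw loses at most a fraction [dt] of it. *)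
have g3 : - f (S :|: O) <= \sum_(x | chosen S x) marg f (S :|: O) x.
  rewrite (eq_bigl [in M]); last by move=> x; rewrite inE.
  apply: le_trans (submodular_union f_sub _ _); rewrite lerBrDr addNr; exact: f_ge0.
have -> : \sum_(x | chosen S x) (potential i (x |: S) - potential i S)
   = coefS i * (\sum_(x | chosen S x) marg f S x)
   + coefO i * (\sum_(x | chosen S x) marg f (S :|: O) x)
   - coefW i * F * lam%:R * (\sum_(x | chosen S x) wcost S x).
  rewrite !mulr_sumr -big_split /= -sumrB; apply: eq_bigr => x /chosen_cand[xS _ _].
  rewrite /potential (total_wgt_add AS xS) /marg setUA; ring.
set s1 := \sum_(x | _) marg f S x in g1 *.
set s2 := \sum_(x | _) _ in g3 *.
set s3 := \sum_(x | _) _ in g2 *.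
have e1 := ler_wpM2l a0 g1.
have e2 := ler_wpM2l b0 g3.
have e3 : coefW i * F * lam%:R * s3
    <= coefW i * F * lam%:R * (total_wgt S * (1 + l%:R^-1)).
  by apply: ler_wpM2l => //; apply: mulr_ge0 (mulr_ge0 w0 F_ge0) (ler0n _ _).
have e : coefS i * (f (S :|: O) - f S) + coefO i * - f (S :|: O)
   - coefW i * F * lam%:R * (total_wgt S * (1 + l%:R^-1))
   <= coefS i * s1 + coefO i * s2 - coefW i * F * lam%:R * s3 by lra.
rewrite -subr_ge0 in e; have := mulr_ge0 (ltW dt_gt0) e.
have cS : coefS i.+1 = (1 - dt) * coefS i by rewrite /coefS exprS.
have cO : coefO i.+1 = dt * coefS i + (1 - dt) * coefO i by [].
have cW : coefW i.+1 = growth * coefW i by rewrite /coefW exprS; ring.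
move=> h; rewrite -subr_ge0; apply: le_trans h _; rewrite le_eqVlt; apply/orP; left.
by apply/eqP; rewrite /potential cS cO cW /growth; ring.
Qed.

(** Backward induction: a fitting choice uses the induction hypothesis, a skipped one
    [potential_overflow] and [value_ge], and an idle draw the hypothesis at [S] itself. *)
Lemma potential_le_value i S : reachable S -> packable c (fun=> 1) S ->
  potential i S <= value N i S.
Proof.
elim: i S => [|i IH] S rS pS.
  rewrite /potential /coefW /coefS expr0 mul1r mul0r addr0 gerBl /=.
  by rewrite expr0 mulr1 !mulr_ge0 ?expR_ge0 // ltW ?total_wgt_gt0.
apply: le_trans (potential_step i rS) _.
set q := value N i S.
have q1 : potential i S <= q := IH S rS pS.
have N0 : 0 < N%:R :> R by rewrite ltr0n.
suff h : N%:R * potential i S + \sum_(x | chosen S x) (potential i (x |: S) - potential i S)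
    <= \sum_(r < N) value N i (after_draw S r).
  rewrite [value _ _ _]/= ler_pdivlMr //; apply: le_trans h.
  by rewrite mulrDl [_ * N%:R]mulrC lerD2l mulrAC mulVf ?mul1r ?gt_eqF.
have sumX (g : X -> R) a : \sum_x (g x + a) = \sum_x g x + #|X|%:R * a.
  by rewrite big_split /= sumr_const mulr_natl.
rewrite (sum_after_draw S (value N i) N_ge) -/q big_mkcond sumX /=.
have h : \sum_x ((if chosen S x then potential i (x |: S) - potential i S else 0) + potential i S)
    <= \sum_x value N i (add_if_chosen S x).
  apply: ler_sum => x _; rewrite /add_if_chosen; case: (boolP (chosen S x)) => [ch|_] /=; last first.
    by rewrite add0r.
  have [_ sx _] := chosen_cand ch.
  rewrite subrK; case: ifP => pk; first by apply: IH => //; apply: reachable_add.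
  apply: le_trans (value_ge i S N_gt0); apply: potential_overflow => //.
  by rewrite pk.
rewrite sumX in h.
have nN : #|X|%:R <= N%:R :> R by rewrite ler_nat.
have := ler_wpM2r (_ : 0 <= q - potential i S) nN; rewrite subr_ge0 => /(_ q1).
lra.
Qed.

End Potential.
End Residual.

(** * Approximation ratio *)

Section Ratio.
Variables (R : realType) (X : finType) (f : {set X} -> R).
Variables (k : nat) (c : X -> 'I_k -> R) (lam : nat).
Hypotheses (c_ge0 : forall i j, 0 <= c i j).
Hypotheses (f_ge0 : forall A, 0 <= f A) (f_sub : submodular f).
Hypotheses (k_gt0 : (0 < k)%N) (lam_k : lam = (768 * k)%N).

Let l := (2 * lam)%N.

Lemma bernoulli_ge (x : R) n : 0 <= x <= 1 -> 1 - n%:R * x <= (1 - x) ^+ n.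
Proof.
case/andP=> x0 x1; elim: n => [|n IH]; first by rewrite mul0r subr0 expr0.
rewrite exprS; apply: le_trans (ler_wpM2l (_ : 0 <= 1 - x) IH); last by rewrite subr_ge0.
rewrite -natr1; have : 0 <= n%:R * (x * x) by rewrite !mulr_ge0.
lra.
Qed.

Lemma packable_sub (A B : {set X}) (C : 'I_k -> R) :
  A \subset B -> packable c C B -> packable c C A.
Proof.
move=> AB /forallP pB; apply/forallP=> j; apply: le_trans (pB j).
by rewrite [leRHS](big_setID A) /= (setIidPr AB) lerDl sumr_ge0.
Qed.

(** For each resource, fewer than [l] elements can each exceed a fraction [1 / l] of the capacity
    left by the core; an exhausted resource admits no such element. *)
Lemma card_not_small (A O : {set X}) : A \subset O -> packable c (fun=> 1) O ->
  (#|[set x in O :\: A | ~~ small c l A x]| <= k * l)%N.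
Proof.
move=> AO pO; set B := [set x in _ | _].
pose Bj j := [set x in O :\: A | cap c A j < c x j * l%:R].
have sB : B \subset \bigcup_j Bj j.
  apply/subsetP=> x; rewrite inE => /andP[xO /forallPn[j]]; rewrite -ltNge => h.
  by apply/bigcupP; exists j => //; rewrite inE xO.
apply: leq_trans (subset_leq_card sB) _.
have -> : (k * l = \sum_(j < k) l)%N by rewrite sum_nat_const card_ord.
apply: leq_trans (_ : (\sum_(j < k) #|Bj j| <= _)%N).
  elim/big_ind2: _ => [|x1 x2 y1 y2 h1 h2|//]; first by rewrite cards0.
  by apply: leq_trans (leq_add h1 h2); rewrite -cardsUI leq_addr.
apply: leq_sum => j _.
have sub : \sum_(x in O :\: A) c x j <= cap c A j.
  rewrite /cap lerBrDl; apply: le_trans (forallP pO j).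
  by rewrite [leRHS](big_setID A) /= (setIidPr AO).
have pA := packable_sub AO pO.
have := cap_ge0 pA j; rewrite le0r => /orP[/eqP cap0|cp].
  rewrite (_ : Bj j = set0) ?cards0 //; apply/setP=> x; rewrite !inE.
  apply/negbTE/negP => /andP[xOA]; rewrite cap0 => h.
  have : 0 < c x j by rewrite lt_neqAle c_ge0 andbT eq_sym; apply: contraTneq h => ->; rewrite mul0r ltxx.
  move: sub; rewrite cap0 (bigD1 x) /=; last by rewrite !inE.
  have : 0 <= \sum_(i in O :\: A | i != x) c i j by apply: sumr_ge0.
  lra.
rewrite -(ler_nat R) -(ler_pM2r cp).
have s1 : \sum_(x in Bj j) cap c A j <= \sum_(x in Bj j) c x j * l%:R.
  by apply: ler_sum => x; rewrite inE => /andP[_ /ltW].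
apply: le_trans (_ : \sum_(x in Bj j) cap c A j <= _).
  by rewrite sumr_const mulr_natl.
apply: le_trans s1 _; rewrite -mulr_suml mulrC ler_wpM2l //; apply: le_trans sub.
have BO : Bj j \subset O :\: A by apply/subsetP=> x; rewrite inE => /andP[].
by rewrite [leRHS](big_setID (Bj j)) /= (setIidPr BO) lerDl sumr_ge0.
Qed.

(** With [N = 4q] and [2q] rounds the coefficient is [(1/2)(1 - 1/N)^(2q - 1)]; Bernoulli gives
    [(1 - 1/N)^q >= 3/4]. *)
Lemma coefO_ge (q : nat) : (0 < q)%N -> 9 / 32 <= coefO R (4 * q) (2 * q).
Proof.
move=> q0; have -> : (2 * q = (2 * q).-1.+1)%N by rewrite prednK // muln_gt0.
rewrite coefO_closed prednK ?muln_gt0 //.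
have q0R : 0 < q%:R :> R by rewrite ltr0n.
set dt : R := (4 * q)%:R^-1.
have qdt : q%:R * dt = 1 / 4.
  by rewrite /dt natrM; field; rewrite ?pnatr_eq0 -?lt0n.
have dt0 : 0 <= dt by rewrite invr_ge0.
have dt1 : dt <= 1 by rewrite invf_le1 ?ltr0n ?ler1n ?muln_gt0.
have e2 : (2 * q)%:R * dt = 1 / 2 by rewrite natrM -mulrA qdt; lra.
have q01 : 0 <= 1 - dt <= 1 by rewrite subr_ge0 dt1 gerBl.
have b1 : 3 / 4 <= (1 - dt) ^+ q.
  by apply: le_trans (bernoulli_ge q (_ : 0 <= dt <= 1)); rewrite ?dt0 ?qdt //; lra.
have b2 : (3 / 4) ^+ 2 <= (1 - dt) ^+ (2 * q) by rewrite mulnC exprM lerXn2r ?nnegrE //; lra.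
have b3 : (1 - dt) ^+ (2 * q) <= (1 - dt) ^+ (2 * q).-1.
  by apply: ler_wiXn2l; rewrite ?leq_pred //; case/andP: q01.
rewrite e2; move: (le_trans b2 b3); rewrite expr2; lra.
Qed.

(** By [1 + y <= exp y] the left side is at most [2k exp(-z)] with [z = lam/6 - 1/4], and
    [exp(-z) <= 1/(1 + z)]. Since [768 = 6 * 128], [1 + z >= 128k]. *)
Lemma coefW_le (q : nat) : (0 < q)%N ->
  coefW R l lam (4 * q) (2 * q) * k%:R <= 1 / 64.
Proof.
move=> q0; have q0R : 0 < q%:R :> R by rewrite ltr0n.
have k1 : 1 <= k%:R :> R by rewrite ler1n.
have lamE : lam%:R = 768 * k%:R :> R by rewrite lam_k natrM.
have lE : l%:R = 2 * lam%:R :> R by rewrite /l natrM.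
have g : lam%:R * (1 + l%:R^-1) = lam%:R + 1 / 2 :> R.
  by rewrite lE; field; rewrite gt_eqF //; lra.
rewrite /coefW g; set y : R := _ * (_ + _).
have y0 : 0 <= y by rewrite mulr_ge0 ?invr_ge0 //; lra.
have h1 : (1 + y) ^+ (2 * q) <= expR (lam%:R / 2 + 1 / 4).
  apply: le_trans (_ : expR y ^+ (2 * q) <= _).
    by rewrite lerXn2r ?nnegrE ?expR_ge1Dx ?expR_ge0 //; lra.
  rewrite -expRM_natl ler_expR le_eqVlt; apply/orP; left; apply/eqP.
  by rewrite /y !natrM; field; rewrite gt_eqF.
have h2 : expR (- (2 / 3 * lam%:R)) * (1 + y) ^+ (2 * q) <= expR (- (lam%:R / 6 - 1 / 4)).
  apply: le_trans (ler_wpM2l (expR_ge0 _) h1) _.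
  by rewrite -expRD ler_expR; lra.
set z : R := lam%:R / 6 - 1 / 4 in h2.
have h3 : expR (- z) * (1 + z) <= 1.
  apply: le_trans (ler_wpM2l (expR_ge0 _) (expR_ge1Dx z)) _.
  by rewrite -expRD addNr expR0.
have h4 : 128 * k%:R <= 1 + z by rewrite /z lamE; lra.
have h5 := ler_wpM2l (expR_ge0 (- z)) h4.
have h6 : expR (- (2 / 3 * lam%:R)) * (1 + y) ^+ (2 * q) * k%:R <= expR (- z) * k%:R.
  by apply: ler_wpM2r => //; lra.
rewrite -!mulrA mulrA in h6 *; move: h6 h3 h5; set u := expR (- z) * k%:R.
rewrite -mulrA => h6 h3 h5; rewrite /u in h6.
lra.
Qed.

Lemma value_ge_quarter (O : {set X}) (q : nat) : (0 < q)%N -> (#|X| <= 4 * q)%N ->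
  packable c (fun=> 1) O -> (forall B, packable c (fun=> 1) B -> f B <= f O) ->
  exists s : seq X, [/\ (size s <= 64 * k * l)%N, packable c (fun=> 1) [set y in s] &
   f O / 4 <= value f c l lam [set y in s] (4 * q) (2 * q) [set y in s]].
Proof.
move=> q0 nq pO Omax; set L := (64 * k * l)%N.
have [s [sL sO H]] := core_guess f_ge0 f_sub L O; exists s.
set A := [set y in s] in H *.
have AO : A \subset O by apply/subsetP=> x; rewrite inE => /sO.
have pA := packable_sub AO pO; split=> //.
pose B := [set x in O :\: A | ~~ small c l A x].
have l0 : (0 < l)%N by rewrite /l lam_k !muln_gt0.
have BO : B \subset O by apply/subsetP=> x; rewrite !inE => /andP[/andP[]].
have AOB : A \subset O :\: B.
  apply/subsetP=> x xA; rewrite in_setD (subsetP AO) // andbT.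
  by apply/negP; rewrite inE in_setD xA.
have pOB : packable c (fun=> 1) (O :\: B) by apply: packable_sub pO; apply: subsetDl.
(* At most [k * l] elements are dropped, each with marginal at most [f A / L]; the factor 64 in [L]
   bounds the loss by [f O / 64]. *)
have loss : 63 / 64 * f O <= f (O :\: B).
  have h1 := submodular_remove f_sub AOB BO.
  have L0 : 0 < L%:R :> R by rewrite ltr0n /L muln_gt0 l0 muln_gt0 k_gt0.
  have h2 : \sum_(x in B) marg f A x <= \sum_(x in B) f A / L%:R.
    apply: ler_sum => x; rewrite inE in_setD => /andP[/andP[xA xO] _].
    by rewrite ler_pdivlMr // mulrC; apply: H => //; move: xA; rewrite inE.
  have h3 : #|B|%:R <= (k * l)%:R :> R by rewrite ler_nat; apply: card_not_small.
  have h4 : \sum_(x in B) f A / L%:R <= f O / 64.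
    rewrite sumr_const -[_ *+ #|_|]mulr_natl mulrCA; apply: le_trans (_ : f A * ((k * l)%:R / L%:R) <= _).
      by apply: ler_wpM2l => //; apply: ler_wpM2r => //; rewrite invr_ge0 ltW.
    have -> : (k * l)%:R / L%:R = 64^-1 :> R.
      rewrite /L -mulnA [X in _ / X]natrM invfM mulrCA mulfV ?mulr1 // pnatr_eq0 -lt0n.
      by rewrite muln_gt0 k_gt0.
    by apply: ler_wpM2r; rewrite ?invr_ge0 // Omax.
  lra.
have smOB : {in (O :\: B) :\: A, forall x, small c l A x}.
  move=> x; rewrite !inE => /andP[xs /andP[+ xO]].
  by rewrite xs xO /= negbK.
have lam0 : (0 < lam)%N by rewrite lam_k muln_gt0.
have q4 : (0 < 4 * q)%N by rewrite muln_gt0.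
have rA : reachable c l A A by split=> // x; rewrite setDv inE.
have h := potential_le_value c_ge0 f_ge0 f_sub k_gt0 lam0 erefl pA nq q4 Omax pOB AOB smOB (2 * q) rA pA.
apply: le_trans h; rewrite /potential total_wgt_init (setUidPr AOB).
have h1 : 0 <= coefS R (4 * q) (2 * q) * f A.
  by rewrite mulr_ge0 //; have /andP[] := coefS_bounds R q4 (2 * q).
have h2 := coefO_ge q0; have h3 := coefW_le q0.
have h4 := ler_wpM2r (f_ge0 O) h3.
have h5 : 9 / 32 * (63 / 64 * f O) <= coefO R (4 * q) (2 * q) * f (O :\: B).
  by apply: ler_pM => //; rewrite ?mulr_ge0 //; lra.
(* [9/32 * 63/64 - 1/64 = 535/2048], which exceeds [1/4]. *)
have := f_ge0 O; lra.
Qed.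

End Ratio.

(** * Expected-value logic for programs *)

(* Bounds the running time of P when no loop of P iterates more than M times. *)
Fixpoint cost (M : nat) (P : cmd) : nat :=
  match P with
  | CSeq P1 P2 => (cost M P1 + cost M P2).+1
  | CIf _ P1 P2 => (cost M P1 + cost M P2).+1
  | CWhile _ P1 => (M * (cost M P1).+1).+1
  | _ => 1
  end.

Lemma cost_poly (d : nat) (P : cmd) :
  exists p : {poly nat}, forall n : nat, p.[n] = cost (n + d) P.
Proof.
have poly1 : exists p : {poly nat}, forall n : nat, p.[n] = 1%N.
  by exists 1 => n; rewrite hornerC.
elim: P => //= [P [p IHp] Q [q IHq]|t P [p IHp] Q [q IHq]|t P [p IHp]].
- by exists (1 + (p + q)) => n; rewrite !hornerD IHp IHq hornerC.
- by exists (1 + (p + q)) => n; rewrite !hornerD IHp IHq hornerC.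
- exists (1 + ('X + d%:P) * (1 + p)) => n.
  by rewrite hornerD hornerM !hornerD hornerX IHp !hornerC.
Qed.

Section Logic.
Variables (R : realType) (X : finType) (f : {set X} -> R) (ok : pred {set X}).

(* From this configuration, T steps always halt with an admissible output  *)
(* whose expected value is at least v.                                        *)
Inductive good : nat -> R -> config R -> Prop :=
  | good_halt T v s : ok (coded_set X s 1) -> v <= f (coded_set X s 1) ->
      good T v ([::], s)
  | good_step T v v1 v0 cf : v <= (v1 + v0) / 2 ->
      good T v1 (step f true cf) -> good T v0 (step f false cf) -> good T.+1 v cf.

Lemma good_le T T' v v' cf : (T <= T')%N -> v' <= v -> good T v cf -> good T' v' cf.
Proof.
move=> TT vv g; elim: g T' v' TT vv => {T v cf} [T v s oks vs|T v v1 v0 cf h _ IH1 _ IH0] T' v' TT vv.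
  by apply: good_halt => //; apply: le_trans vs.
case: T' TT => // T' TT; apply: (@good_step _ _ v1 v0); first exact: le_trans h.
  exact: IH1.
exact: IH0.
Qed.

Definition exec (cf : config R) (w : seq bool) : config R :=
  foldl (fun cf coin => step f coin cf) cf w.

Lemma exec_halted s w : exec ([::], s) w = ([::], s).
Proof. by elim: w => //= b w IH. Qed.

Lemma sum_tuple_cons T (Z : T.+1.-tuple bool -> R) :
  \sum_w Z w = \sum_(w : T.-tuple bool) Z [tuple of true :: w]
             + \sum_(w : T.-tuple bool) Z [tuple of false :: w].
Proof.
pose h (p : bool * T.-tuple bool) : T.+1.-tuple bool := [tuple of p.1 :: p.2].
have bij_h : bijective h.
  exists (fun w => (thead w, [tuple of behead w])) => [[b w]|w].
    by congr pair; apply: val_inj.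
  by rewrite [RHS]tuple_eta.
rewrite (reindex h) /=; last exact: onW_bij.
rewrite -(pair_big predT predT (fun b w => Z (h (b, w)))) /=.
by rewrite big_bool.
Qed.

Lemma good_sound T v cf : good T v cf ->
  (forall w : T.-tuple bool, halted (exec cf w) /\ ok (coded_set X (exec cf w).2 1)) /\
  v <= coin_expectation (fun w : T.-tuple bool => f (coded_set X (exec cf w).2 1)).
Proof.
elim=> {T v cf} [T v s oks vs|T v v1 v0 cf h _ [IH1 IE1] _ [IH0 IE0]]; split.
- by move=> w; rewrite exec_halted.
- rewrite /coin_expectation ler_pdivlMr ?exprn_gt0 //.
  under eq_bigr do rewrite exec_halted.
  rewrite sumr_const card_tuple card_bool -natrX mulr_natr.
  by rewrite lerMn2r vs orbT.
- by move=> w; rewrite (tuple_eta w) /=; case: (thead w).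
- apply: le_trans h _; rewrite /coin_expectation sum_tuple_cons /=.
  have -> a b : (a + b) / 2 ^+ T.+1 = (a / 2 ^+ T + b / 2 ^+ T) / 2 :> R.
    by rewrite exprSr invfM; ring.
  by apply: ler_wpM2r; [rewrite invr_ge0 | apply: lerD].
Qed.

Variable M : nat.

(* Executing P from s guarantees the expected value v, provided that the     *)
(* continuation guarantees v' from s' whenever Post s' v' holds.              *)
Definition wp (P : cmd) (s : state R) (v : R) (Post : state R -> R -> Prop) : Prop :=
  forall K T, (forall s' v', Post s' v' -> good T v' (K, s')) ->
  good (cost M P + T) v (P :: K, s).

Lemma wp_conseq P s v v' (Post Post' : state R -> R -> Prop) :
  wp P s v Post' -> v' <= v -> (forall s' u, Post' s' u -> Post s' u) -> wp P s v' Post.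
Proof.
move=> h vv hP K T g; apply: (good_le (leqnn _) vv).
by apply: h => s' u /hP; apply: g.
Qed.

Lemma wp_det P s s' v (Post : state R -> R -> Prop) : cost M P = 1%N ->
  (forall b K, step f b (P :: K, s) = (K, s')) -> Post s' v -> wp P s v Post.
Proof.
move=> c1 st ps K T g; rewrite c1; apply: (@good_step _ _ v v); rewrite ?st.
- by lra.
- exact: g.
- exact: g.
Qed.

Definition iset (s : state R) a i x := State (upd (imem s) a i x) (rmem s).
Definition rset (s : state R) a i x := State (imem s) (upd (rmem s) a i x).

Lemma wp_skip s v (Post : state R -> R -> Prop) : Post s v -> wp CSkip s v Post.
Proof. exact: wp_det. Qed.

Lemma wp_iset a i e s v (Post : state R -> R -> Prop) :
  Post (iset s a (ieval s i) (ieval s e)) v -> wp (CISet a i e) s v Post.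
Proof. exact: wp_det. Qed.

Lemma wp_rset a i e s v (Post : state R -> R -> Prop) :
  Post (rset s a (ieval s i) (reval s e)) v -> wp (CRSet a i e) s v Post.
Proof. exact: wp_det. Qed.

Lemma wp_query a i b s v (Post : state R -> R -> Prop) :
  Post (rset s a (ieval s i) (f (coded_set X s b))) v -> wp (CQuery a i b) s v Post.
Proof. exact: wp_det. Qed.

Lemma wp_flip a i s v v1 v0 (Post : state R -> R -> Prop) : v <= (v1 + v0) / 2 ->
  Post (iset s a (ieval s i) 1%N) v1 -> Post (iset s a (ieval s i) 0%N) v0 ->
  wp (CFlip a i) s v Post.
Proof.
by move=> h p1 p0 K T g; apply: (@good_step _ _ v1 v0) => //; apply: g.
Qed.

Lemma good_det1 T v cf cf' : (forall b, step f b cf = cf') -> good T v cf' -> good T.+1 v cf.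
Proof.
move=> st g; apply: (@good_step _ _ v v); rewrite ?st //.
by lra.
Qed.

Lemma wp_seq P Q s v (Post : state R -> R -> Prop) :
  wp P s v (fun s' v' => wp Q s' v' Post) -> wp (CSeq P Q) s v Post.
Proof.
move=> h K T g; rewrite /= addSn -addnA.
apply: (@good_det1 _ _ _ (P :: Q :: K, s)) => //.
by apply: h => s' v' hQ; apply: hQ.
Qed.

Lemma wp_if t P Q s v (Post : state R -> R -> Prop) :
  (beval s t -> wp P s v Post) -> (~~ beval s t -> wp Q s v Post) ->
  wp (CIf t P Q) s v Post.
Proof.
move=> hP hQ K T g; rewrite /= addSn.
apply: (@good_det1 _ _ _ ((if beval s t then P else Q) :: K, s)) => //.
case: ifPn => bt.
  by apply: good_le (hP bt K T g); rewrite // leq_add2r leq_addr.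
by apply: good_le (hQ bt K T g); rewrite // leq_add2r leq_addl.
Qed.

(** The index of [Inv] is the exact number of iterations left: the guard holds while it is positive
    and fails at zero. *)
Lemma wp_while t P n s v (Inv : nat -> state R -> R -> Prop) (Post : state R -> R -> Prop) :
  (n <= M)%N -> Inv n s v ->
  (forall i s v, (i < n)%N -> Inv i.+1 s v -> beval s t /\ wp P s v (Inv i)) ->
  (forall s v, Inv 0%N s v -> ~~ beval s t /\ Post s v) ->
  wp (CWhile t P) s v Post.
Proof.
move=> nM I hS h0 K T g.
suff: good ((n * (cost M P).+1).+1 + T) v (CWhile t P :: K, s).
  by apply: good_le; rewrite // leq_add2r ltnS leq_mul2r nM orbT.
elim: n s v {nM} I hS => [|n IH] s v I hS; rewrite addSn.
  have [bt ps] := h0 _ _ I; apply: (@good_det1 _ _ _ (K, s)); last exact: g.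
  by move=> b /=; rewrite (negPf bt).
have [bt w] := hS n s v (ltnSn n) I.
apply: (@good_det1 _ _ _ (P :: CWhile t P :: K, s)) => [b|]; first by rewrite /= bt.
apply: good_le (w (CWhile t P :: K) ((n * (cost M P).+1).+1 + T)%N _) => //; first by lia.
by move=> s' v' I'; apply: IH I' _ => i s1 v1 i_n; apply: hS; apply: ltnW.
Qed.

End Logic.

(** * The program *)

Section Program.
Variables (k l lam : nat).

Definition scalar (i : nat) : iexp := IGet 3 (INat i).
Definition set_scalar (i : nat) (e : iexp) : cmd := CISet 3 (INat i) e.
Definition rscalar (i : nat) : rexp := RGet (k + 3) (INat i).
Definition set_rscalar (i : nat) (e : rexp) : cmd := CRSet (k + 3) (INat i) e.
Definition size_e : iexp := IGet 0 (INat 0).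
Definition ilt (a b : iexp) : bexp := BILe (IAdd a (INat 1)) b.
Definition rlt (a b : rexp) : bexp := BNot (BRLe b a).
Definition bor (a b : bexp) : bexp := BNot (BAnd (BNot a) (BNot b)).

Fixpoint rsum (m : nat) (E : nat -> rexp) : rexp :=
  if m is m'.+1 then RAdd (rsum m' E) (E m') else RNat (INat 0).
Fixpoint ball (m : nat) (t : nat -> bexp) : bexp :=
  if m is m'.+1 then BAnd (ball m' t) (t m') else BILe (INat 0) (INat 0).
Fixpoint set_vector (m a : nat) (E : nat -> rexp) : cmd :=
  if m is m'.+1 then CSeq (set_vector m' a E) (CRSet a (INat m') (E m')) else CSkip.

(* Index arrays: 1 output, 2 current set, 3 scalars, 4 guessed core.          *)
(* Real arrays: k weights, k+1 remaining capacities, k+2 capacities left by   *)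
(* the core, k+3 scalars. Cells of the scalar arrays: index 0 number of       *)
(* random draws, 1 drawn element, 2 coin, 3 loop counter, 4 round; real 0     *)
(* best value, 1 current value, 2 and 3 values with one more element, 4 cost. *)
Definition not_in (x : iexp) : bexp := BILe (IGet 2 x) (INat 0).
Definition is_small (x : iexp) : bexp :=
  ball k (fun j => BRLe (RMul (RGet j x) (RNat (INat l))) (RGet (k + 2) (INat j))).
Definition fits (x : iexp) : bexp :=
  ball k (fun j => BRLe (RGet j x) (RGet (k + 1) (INat j))).
Definition share_e (x : iexp) (j : nat) : rexp := RDiv (RGet j x) (RGet (k + 2) (INat j)).
Definition wcost_e (x : iexp) : rexp :=
  rsum k (fun j => RMul (RGet k (INat j)) (share_e x j)).
Definition total_wgt_e : rexp := rsum k (fun j => RGet k (INat j)).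

Definition add_element (x : iexp) : cmd :=
  CSeq (CISet 2 x (INat 1))
       (set_vector k (k + 1) (fun j => RSub (RGet (k + 1) (INat j)) (RGet j x))).
Definition update_weights (x : iexp) : cmd :=
  set_vector k k (fun j => RMul (RGet k (INat j))
    (RAdd (RNat (INat 1)) (RMul (RNat (INat lam)) (share_e x j)))).
Definition probe (x : iexp) (dst : nat) : cmd :=
  CSeq (CISet 2 x (INat 1)) (CSeq (CQuery (k + 3) (INat dst) 2) (CISet 2 x (INat 0))).
Definition for_elements (P : cmd) : cmd :=
  CSeq (set_scalar 3 (INat 0))
    (CWhile (ilt (scalar 3) size_e)
      (CSeq P (set_scalar 3 (IAdd (scalar 3) (INat 1))))).

(** Each doubling of scalar 0 appends one coin to the binary expansion in scalar 1, giving a uniform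
    number below a power of two. *)
Definition draw : cmd :=
  CSeq (set_scalar 0 (INat 1)) (CSeq (set_scalar 1 (INat 0))
    (CWhile (ilt (scalar 0) (IAdd size_e (INat 3)))
      (CSeq (CFlip 3 (INat 2))
      (CSeq (set_scalar 1 (IAdd (IAdd (scalar 1) (scalar 1)) (scalar 2)))
            (set_scalar 0 (IAdd (scalar 0) (scalar 0))))))).

Definition denser_e : bexp :=
  let a := RMul (RSub (rscalar 2) (rscalar 1)) (wcost_e (scalar 3)) in
  let b := RMul (RSub (rscalar 3) (rscalar 1)) (wcost_e (scalar 1)) in
  bor (rlt a b) (BAnd (BRLe a b) (ilt (scalar 3) (scalar 1))).

Definition add_cost : cmd :=
  CIf (BAnd (not_in (scalar 3)) (is_small (scalar 3)))
    (CSeq (probe (scalar 3) 3)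
      (CIf (BAnd (rlt (rscalar 1) (rscalar 3)) denser_e)
        (set_rscalar 4 (RAdd (rscalar 4) (wcost_e (scalar 3)))) CSkip)) CSkip.

Definition compute_cost : cmd :=
  CSeq (set_rscalar 4 (RNat (INat 0))) (for_elements add_cost).

Definition try_add : cmd :=
  CIf (BAnd (ilt (scalar 1) size_e) (BAnd (not_in (scalar 1))
        (BAnd (is_small (scalar 1)) (fits (scalar 1)))))
    (CSeq (CQuery (k + 3) (INat 1) 2)
    (CSeq (probe (scalar 1) 2)
      (CIf (rlt (rscalar 1) (rscalar 2))
        (CSeq compute_cost
          (CIf (rlt (rscalar 4) total_wgt_e)
            (CSeq (update_weights (scalar 1)) (add_element (scalar 1))) CSkip))
        CSkip)))
    CSkip.

Definition rounds : cmd :=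
  CSeq draw (CSeq (set_scalar 4 (INat 0))
    (CWhile (ilt (IAdd (scalar 4) (scalar 4)) (scalar 0))
      (CSeq draw (CSeq try_add (set_scalar 4 (IAdd (scalar 4) (INat 1))))))).

Fixpoint build_core (L : nat) : cmd :=
  if L is L'.+1 then
    let x := IGet 4 (INat L') in
    CSeq (build_core L')
      (CIf (BAnd (ilt x size_e) (BAnd (not_in x) (fits x))) (add_element x) CSkip)
  else CSkip.

Definition keep_best : cmd :=
  CSeq (CQuery (k + 3) (INat 2) 2)
    (CIf (rlt (rscalar 0) (rscalar 2))
      (CSeq (for_elements (CISet 1 (scalar 3) (IGet 2 (scalar 3))))
            (set_rscalar 0 (rscalar 2))) CSkip).

Definition attempt (L : nat) : cmd :=
  CSeq (for_elements (CISet 2 (scalar 3) (INat 0)))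
  (CSeq (set_vector k (k + 1) (fun=> RNat (INat 1)))
  (CSeq (build_core L)
  (CSeq (set_vector k (k + 2) (fun j => RGet (k + 1) (INat j)))
  (CSeq (set_vector k k (fun=> RNat (INat 1)))
  (CSeq rounds keep_best))))).

(** The [m] nested loops are unrolled in the syntax, so constant [L] keeps the time polynomial. The
    cell value [#|X|] stands for no element. *)
Fixpoint all_guesses (m : nat) (P : cmd) : cmd :=
  if m is m'.+1 then
    CSeq (CISet 4 (INat m') (INat 0))
      (CWhile (BILe (IGet 4 (INat m')) size_e)
        (CSeq (all_guesses m' P) (CISet 4 (INat m') (IAdd (IGet 4 (INat m')) (INat 1)))))
  else P.

Definition program (L : nat) : cmd :=
  CSeq (CQuery (k + 3) (INat 0) 1) (all_guesses L (attempt L)).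

End Program.

(** * Memory invariant and specifications of the basic commands *)

Section Correctness.
Variables (R : realType) (X : finType) (f : {set X} -> R).
Variables (k l lam : nat) (c : X -> 'I_k -> R).

(** Index scalars 2 and 3 and the real scalars other than 0 are scratch and stay unconstrained. *)
Record inv (S D : {set X}) (w rem cp : 'I_k -> R) (g : nat -> nat) (best : R)
    (N r t : nat) (s : state R) : Prop := Inv {
  inv_n : imem s 0 0 = #|X|;
  inv_D : forall x : X, imem s 1 (enum_rank x) = (x \in D);
  inv_S : forall x : X, imem s 2 (enum_rank x) = (x \in S);
  inv_g : forall i, imem s 4 i = g i;
  inv_N : imem s 3 0 = N;
  inv_r : imem s 3 1 = r;
  inv_t : imem s 3 4 = t;
  inv_c : forall (x : X) (j : 'I_k), rmem s j (enum_rank x) = c x j;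
  inv_w : forall j : 'I_k, rmem s k j = w j;
  inv_rem : forall j : 'I_k, rmem s (k + 1) j = rem j;
  inv_cp : forall j : 'I_k, rmem s (k + 2) j = cp j;
  inv_best : rmem s (k + 3) 0 = best }.

Lemma coded_set_bool (s : state R) a (S : {set X}) :
  (forall x : X, imem s a (enum_rank x) = (x \in S)) -> coded_set X s a = S.
Proof. by move=> h; apply/setP=> x; rewrite inE h; case: (x \in S). Qed.

Section Updates.
Variables (S D : {set X}) (w rem cp : 'I_k -> R) (g : nat -> nat) (best : R).
Variables (N r t : nat) (s : state R).
Hypothesis I : inv S D w rem cp g best N r t s.

Local Ltac inv_tac :=
  case: I => *; split => /= *; rewrite /upd ?eqxx //=.

Lemma inv_draws x : inv S D w rem cp g best x r t (iset s 3 0 x).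
Proof. by inv_tac. Qed.

Lemma inv_drawn x : inv S D w rem cp g best N x t (iset s 3 1 x).
Proof. by inv_tac. Qed.

Lemma inv_round x : inv S D w rem cp g best N r x (iset s 3 4 x).
Proof. by inv_tac. Qed.

Lemma inv_scratch i x : (1 < i < 4)%N -> inv S D w rem cp g best N r t (iset s 3 i x).
Proof. by case: i => [|[|[|[|i]]]] // _; inv_tac. Qed.

Lemma inv_guess i x :
  inv S D w rem cp (fun m => if m == i then x else g m) best N r t (iset s 4 i x).
Proof. by inv_tac; case: eqP. Qed.

Let rank_eq (x y : X) : (nat_of_ord (enum_rank x) == enum_rank y) = (x == y).
Proof. by rewrite (inj_eq val_inj) (inj_eq enum_rank_inj). Qed.

Lemma inv_set_S x (b : bool) :
  inv (if b then x |: S else S :\ x) D w rem cp g best N r t (iset s 2 (enum_rank x) b).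
Proof.
by inv_tac; rewrite rank_eq; case: b; rewrite !inE; case: eqP.
Qed.

Lemma inv_set_D x (b : bool) :
  inv S (if b then x |: D else D :\ x) w rem cp g best N r t (iset s 1 (enum_rank x) b).
Proof.
by inv_tac; rewrite rank_eq; case: b; rewrite !inE; case: eqP.
Qed.

Let ord_neq (j : 'I_k) a : (nat_of_ord j == k + a)%N = false.
Proof. by apply/eqP; have := ltn_ord j; lia. Qed.

Let k_neq a : (k == k + a.+1)%N = false.
Proof. by apply/eqP; lia. Qed.

Lemma inv_set_best x : inv S D w rem cp g x N r t (rset s (k + 3) 0 x).
Proof. by inv_tac; rewrite ?ord_neq ?eqn_add2l ?k_neq /=. Qed.

Lemma inv_rscratch i x : (0 < i)%N -> inv S D w rem cp g best N r t (rset s (k + 3) i x).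
Proof.
by case: i => // i _; inv_tac; rewrite ?ord_neq ?eqn_add2l ?k_neq ?andbF /=.
Qed.

End Updates.

Lemma reval_rsum (s : state R) m E : reval s (rsum m E) = \sum_(j < m) reval s (E j).
Proof. by elim: m => [|m IH]; rewrite ?big_ord0 // big_ord_recr /= IH. Qed.

Lemma beval_ball (s : state R) m t : beval s (ball m t) = [forall j : 'I_m, beval s (t j)].
Proof.
transitivity (\big[andb/true]_(j < m) beval s (t j)); last by rewrite big_andE.
elim: m => [|m IH]; first by rewrite big_ord0.
by rewrite big_ord_recr /= IH andbC.
Qed.

Section Expressions.
Variables (S D : {set X}) (w rem cp : 'I_k -> R) (g : nat -> nat) (best : R).
Variables (N r t : nat) (s : state R) (e : iexp) (x : X).
Hypothesis I : inv S D w rem cp g best N r t s.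
Hypothesis ex : ieval s e = enum_rank x.

Lemma beval_not_in : beval s (not_in e) = (x \notin S).
Proof. by rewrite /= ex (inv_S I); case: (x \in S). Qed.

Lemma beval_small : beval s (is_small k l e) = [forall j, c x j * l%:R <= cp j].
Proof.
rewrite beval_ball; apply: eq_forallb => j /=.
by rewrite ex (inv_c I) (inv_cp I).
Qed.

Lemma beval_fits : beval s (fits k e) = [forall j, c x j <= rem j].
Proof.
by rewrite beval_ball; apply: eq_forallb => j /=; rewrite ex (inv_c I) (inv_rem I).
Qed.

Lemma reval_wcost : reval s (wcost_e k e) = \sum_j w j * (c x j / cp j).
Proof.
rewrite reval_rsum; apply: eq_bigr => j _ /=.
by rewrite ex (inv_c I) (inv_cp I) (inv_w I).
Qed.

End Expressions.

Lemma reval_total_wgt S D w rem cp g best N r t s :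
  inv S D w rem cp g best N r t s -> reval s (total_wgt_e k) = \sum_j w j.
Proof. by move=> I; rewrite reval_rsum; apply: eq_bigr => j _ /=; rewrite (inv_w I). Qed.

Variables (ok : pred {set X}).
Let M := (#|X| + 3)%N.
Local Notation wp := (wp f ok M).

(** Cells are written in increasing order, so the expression for cell [j] may still read the old
    cells of [a] from [j] on. *)
Lemma wp_set_vector a E (W : 'I_k -> R) (s : state R) v (Post : state R -> R -> Prop) :
  (forall (j : 'I_k) s', imem s' = imem s ->
     (forall a' i, (a' != a) || (j <= i)%N -> rmem s' a' i = rmem s a' i) ->
     reval s' (E (j : nat)) = W j) ->
  (forall s', imem s' = imem s -> (forall j : 'I_k, rmem s' a j = W j) ->
     (forall a' i, a' != a -> rmem s' a' i = rmem s a' i) -> Post s' v) ->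
  wp (set_vector k a E) s v Post.
Proof.
move=> hE hP.
suff: forall m, (m <= k)%N -> wp (set_vector m a E) s v (fun s' v' =>
    [/\ v' = v, imem s' = imem s, forall j : 'I_k, (j < m)%N -> rmem s' a j = W j &
     forall a' i, (a' != a) || (m <= i)%N -> rmem s' a' i = rmem s a' i]).
  move=> /(_ k (leqnn _)) h; apply: wp_conseq h _ _ => // s' _ [-> e1 e2 e3].
  by apply: hP => // [j|a' i h]; [apply: e2 | apply: e3; rewrite h].
elim=> [|m IH] mk /=; first by apply: wp_skip; split.
apply: wp_seq; apply: wp_conseq (IH (ltnW mk)) _ _ => // s' _ [-> e1 e2 e3].
apply: wp_rset; split=> //= [j|a' i].
  rewrite /upd eqxx ltnS leq_eqVlt /=; case: eqP => [jm _|_ /= /e2//].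
  have -> : m = Ordinal mk by [].
  by rewrite (hE (Ordinal mk) s' e1 e3); congr W; apply: val_inj.
rewrite /upd => h; rewrite (_ : _ && _ = false).
  by apply: e3; case/orP: h => [->//|/ltnW->]; rewrite orbT.
by case/orP: h => [/negPf->//|h]; rewrite [i == m]gtn_eqF ?andbF.
Qed.

Section VectorUpdates.
Variables (S D : {set X}) (w rem cp : 'I_k -> R) (g : nat -> nat) (best : R).
Variables (N r t : nat) (s : state R).
Hypothesis I : inv S D w rem cp g best N r t s.

Let lt_neq (j : 'I_k) a : (k <= a)%N -> nat_of_ord j != a.
Proof. by have := ltn_ord j; lia. Qed.

Lemma wp_set_remaining E (W : 'I_k -> R) v (Post : state R -> R -> Prop) :
  (forall (j : 'I_k) s', imem s' = imem s ->
     (forall a' i, (a' != k + 1) || (j <= i)%N -> rmem s' a' i = rmem s a' i) ->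
     reval s' (E (j : nat)) = W j) ->
  (forall s', inv S D w W cp g best N r t s' -> Post s' v) ->
  wp (set_vector k (k + 1) E) s v Post.
Proof.
move=> h hP; apply: wp_set_vector h _ => s' e1 e2 e3; apply: hP.
case: I => *; split; rewrite ?e1 // => *; rewrite e3 // ?lt_neq //; lia.
Qed.

Lemma wp_set_weights E (W : 'I_k -> R) v (Post : state R -> R -> Prop) :
  (forall (j : 'I_k) s', imem s' = imem s ->
     (forall a' i, (a' != k) || (j <= i)%N -> rmem s' a' i = rmem s a' i) ->
     reval s' (E (j : nat)) = W j) ->
  (forall s', inv S D W rem cp g best N r t s' -> Post s' v) ->
  wp (set_vector k k E) s v Post.
Proof.
move=> h hP; apply: wp_set_vector h _ => s' e1 e2 e3; apply: hP.
case: I => *; split; rewrite ?e1 // => *; rewrite e3 // ?lt_neq //; lia.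
Qed.

Lemma wp_set_caps E (W : 'I_k -> R) v (Post : state R -> R -> Prop) :
  (forall (j : 'I_k) s', imem s' = imem s ->
     (forall a' i, (a' != k + 2) || (j <= i)%N -> rmem s' a' i = rmem s a' i) ->
     reval s' (E (j : nat)) = W j) ->
  (forall s', inv S D w rem W g best N r t s' -> Post s' v) ->
  wp (set_vector k (k + 2) E) s v Post.
Proof.
move=> h hP; apply: wp_set_vector h _ => s' e1 e2 e3; apply: hP.
case: I => *; split; rewrite ?e1 // => *; rewrite e3 // ?lt_neq //; lia.
Qed.

Lemma wp_add_element a i x v (Post : state R -> R -> Prop) :
  a != 2%N -> imem s a i = enum_rank x ->
  (forall s', inv (x |: S) D w (fun j => rem j - c x j) cp g best N r t s' -> Post s' v) ->
  wp (add_element k (IGet a (INat i))) s v Post.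
Proof.
move=> a2 ex hP; apply: wp_seq; apply: wp_iset; rewrite /= ex.
have I1 := inv_set_S I x true.
apply: (@wp_set_vector _ _ (fun j => rem j - c x j)) => [j s' e1 e2|s' e1 e2 e3]; last apply: hP.
  rewrite /= e1 /= /upd (negPf a2) /= ex !e2 ?leqnn ?orbT //=; last first.
    by rewrite lt_neq // leq_addr.
  by rewrite (inv_rem I) (inv_c I).
by case: I1 => *; split; rewrite ?e1 // => *; rewrite e3 // ?lt_neq //; lia.
Qed.

Lemma wp_update_weights a i x v (Post : state R -> R -> Prop) :
  imem s a i = enum_rank x ->
  (forall s', imem s' a i = imem s a i ->
    inv S D (fun j => w j * (1 + lam%:R * (c x j / cp j))) rem cp g best N r t s' ->
     Post s' v) ->
  wp (update_weights k lam (IGet a (INat i))) s v Post.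
Proof.
move=> ex hP.
apply: (@wp_set_vector _ _ (fun j => w j * (1 + lam%:R * (c x j / cp j)))) => [j s' e1 e2|s' e1 e2 e3]; last apply: hP.
- rewrite /= e1 ex !e2 ?leqnn ?orbT ?lt_neq //=.
  by rewrite (inv_w I) (inv_c I) (inv_cp I).
- by rewrite e1.
by case: I => *; split; rewrite ?e1 // => *; rewrite e3 // ?lt_neq //; lia.
Qed.

Lemma wp_probe a i x d v (Post : state R -> R -> Prop) :
  a != 2%N -> (0 < d)%N -> x \notin S -> imem s a i = enum_rank x ->
  (forall s', inv S D w rem cp g best N r t s' -> imem s' 3 =1 imem s 3 ->
    (forall m, rmem s' (k + 3) m = if m == d then f (x |: S) else rmem s (k + 3) m) ->
    Post s' v) ->
  wp (probe k (IGet a (INat i)) d) s v Post.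
Proof.
move=> a2 d0 xS ex hP; apply: wp_seq; apply: wp_iset; rewrite /= ex.
have I1 := inv_set_S I x true.
apply: wp_seq; apply: wp_query; rewrite (coded_set_bool (inv_S I1)) /=.
have I2 := inv_rscratch I1 (f (x |: S)) d0.
have I3 := inv_set_S I2 x false.
apply: wp_iset; rewrite /= [upd _ _ _ _ a i]/upd (negPf a2) /= ex.
apply: hP => [||m].
- by rewrite setU1K // in I3.
- by move=> m /=; rewrite /upd.
- by rewrite /= /upd eqxx.
Qed.

End VectorUpdates.

Lemma wp_for_elements P s v (J : nat -> state R -> Prop) (Post : state R -> R -> Prop) :
  (forall m s, J m s -> imem s 0 0 = #|X|) ->
  (forall m s i, J m s -> J m (iset s 3 3 i)) ->
  J 0%N s ->
  (forall m (x : X) s, enum_rank x = m :> nat -> imem s 3 3 = m -> J m s ->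
     wp P s v (fun s' v' => [/\ v' = v, imem s' 3 3 = m & J m.+1 s'])) ->
  (forall s', J #|X| s' -> Post s' v) ->
  wp (for_elements P) s v Post.
Proof.
move=> Jn Ji J0 hP hQ; apply: wp_seq; apply: wp_iset => /=.
pose I i s v' := exists m, [/\ (m + i = #|X|)%N, v' = v, imem s 3 3 = m & J m s].
apply: (@wp_while _ _ _ _ _ _ _ #|X| _ _ I); first exact: leq_addr.
- by exists 0%N; split=> //; apply: Ji.
- move=> i s1 _ _ [m [mi -> e1 J1]]; rewrite /= e1 (Jn _ _ J1) addn1; split; first by lia.
  have mX : (m < #|X|)%N by lia.
  apply: wp_seq; pose x : X := enum_val (Ordinal mX).
  have rx : enum_rank x = m :> nat by rewrite /x enum_valK.
  apply: wp_conseq (hP m x s1 rx e1 J1) _ _ => // s2 _ [-> e2 J2].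
  apply: wp_iset; rewrite /= e2; exists m.+1; split=> //; first by lia.
    by rewrite /= /upd /= addn1.
  exact: Ji.
- move=> s1 _ [m [mi -> e1 J1]]; rewrite /= e1 (Jn _ _ J1) addn1; split; first by lia.
  by apply: hQ; rewrite -mi addn0.
Qed.

End Correctness.

(** * Correctness of the rounds *)

Lemma inv_eq (R : realType) (X : finType) k (c : X -> 'I_k -> R) S D w w' rem rem' cp cp'
    g best N r t s :
  w =1 w' -> rem =1 rem' -> cp =1 cp' ->
  inv c S D w rem cp g best N r t s -> inv c S D w' rem' cp' g best N r t s.
Proof.
move=> ew er ec [h1 h2 h3 h4 h5 h6 h7 h8 h9 h10 h11 h12]; split=> // j.
- by rewrite h9.
- by rewrite h10.
- by rewrite h11.
Qed.

Section Rounds.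
Variables (R : realType) (X : finType) (f : {set X} -> R) (ok : pred {set X}).
Variables (k l lam : nat) (c : X -> 'I_k -> R) (A : {set X}).
Variables (D : {set X}) (g : nat -> nat) (best : R).

Let M := (#|X| + 3)%N.
Local Notation wp := (wp f ok M).

Definition round_inv (S : {set X}) (N r t : nat) (s : state R) : Prop :=
  inv c S D (wgt c lam A S) (fun j => 1 - \sum_(i in S) c i j) (cap c A) g best N r t s.

Lemma beval_rlt (s : state R) a b : beval s (rlt a b) = (reval s a < reval s b).
Proof. by rewrite /= -ltNge. Qed.

Lemma beval_bor (s : state R) a b : beval s (bor a b) = beval s a || beval s b.
Proof. by rewrite /= negb_and !negbK. Qed.

Lemma beval_ilt (s : state R) a b : beval s (ilt a b) = (ieval s a < ieval s b)%N.
Proof. by rewrite /= addn1. Qed.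

Lemma beval_and (s : state R) a b : beval s (BAnd a b) = beval s a && beval s b.
Proof. by []. Qed.

Lemma beval_rle (s : state R) a b : beval s (BRLe a b) = (reval s a <= reval s b).
Proof. by []. Qed.

Lemma reval_mul (s : state R) a b : reval s (RMul a b) = reval s a * reval s b.
Proof. by []. Qed.

Lemma wp_compute_cost (S : {set X}) (x : X) N r t s v (Post : state R -> R -> Prop) :
  round_inv S N r t s -> enum_rank x = r :> nat ->
  rmem s (k + 3) 1 = f S -> rmem s (k + 3) 2 = f (x |: S) ->
  (forall s', round_inv S N r t s' ->
     rmem s' (k + 3) 4
       = cost_before (cand c l A S) (marg f S) (wcost c lam A S) x ->
     Post s' v) ->
  wp (compute_cost k l) s v Post.
Proof.
move=> I xr e1 e2 hP; apply: wp_seq; apply: wp_rset => /=.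
(* The part of [cost_before] due to elements of rank below [m]: the state of the accumulator after
   [m] iterations. *)
pose costm m := \sum_(y | [&& cand c l A S y, 0 < marg f S y &
  denser (marg f S) (wcost c lam A S) y x] && (enum_rank y < m)%N) wcost c lam A S y.
pose J m s := [/\ round_inv S N r t s, rmem s (k + 3) 1 = f S,
  rmem s (k + 3) 2 = f (x |: S) & rmem s (k + 3) 4 = costm m].
apply: (wp_for_elements (J := J)).
- by move=> m s1 [/inv_n].
- by move=> m s1 i [I1 ? ? ?]; split=> //; apply: inv_scratch.
- split; rewrite /= /upd ?eqxx ?eqxx //=.
  + exact: inv_rscratch.
  + by rewrite /costm big_pred0 // => y; rewrite ltn0 andbF.
- move=> m y s1 ym ei [I1 h1 h2 h4].
  have ey : ieval s1 (scalar 3) = enum_rank y by rewrite /= ei ym.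
  have costS : costm m.+1 = costm m +
     (if [&& cand c l A S y, 0 < marg f S y &
       denser (marg f S) (wcost c lam A S) y x] then wcost c lam A S y else 0).
    rewrite /costm addrC; case: ifP => hy.
      rewrite (bigD1 y) /=; last by rewrite hy ym ltnSn.
      congr (_ + _); apply: eq_bigl => z; rewrite -andbA; congr (_ && _).
      rewrite ltnS leq_eqVlt -ym (inj_eq val_inj) (inj_eq enum_rank_inj).
      by case: eqVneq => [->|] /=; rewrite ?ltnn ?andbT.
    rewrite add0r; apply: eq_bigl => z; rewrite ltnS leq_eqVlt -ym.
    rewrite (inj_eq val_inj) (inj_eq enum_rank_inj).
    by case: eqVneq => [->|] //=; rewrite ltnn hy.
  apply: wp_if; rewrite beval_and (beval_not_in I1 ey) (beval_small l I1 ey).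
    case/andP=> yS ysm.
    apply: wp_seq; apply: (wp_probe I1 (x := y)) => //.
    move=> s2 I2 e3 erm.
    have {}ey : ieval s2 (scalar 3) = enum_rank y by rewrite /= e3 ei ym.
    have ex : ieval s2 (scalar 1) = enum_rank x by rewrite /= (inv_r I2) xr.
    have r1 : rmem s2 (k + 3) 1 = f S by rewrite erm.
    have r2 : rmem s2 (k + 3) 2 = f (x |: S) by rewrite erm.
    have r3 : rmem s2 (k + 3) 3 = f (y |: S) by rewrite erm eqxx.
    have r4 : rmem s2 (k + 3) 4 = costm m by rewrite erm.
    have guardE : beval s2 (BAnd (rlt (rscalar k 1) (rscalar k 3)) (denser_e k))
       = (0 < marg f S y) && denser (marg f S) (wcost c lam A S) y x.
      rewrite beval_and beval_rlt /denser_e beval_bor beval_and beval_rlt beval_ilt.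
      rewrite beval_rle !reval_mul (reval_wcost I2 ey) (reval_wcost I2 ex) ey ex /= r1 r2 r3.
      by rewrite /marg subr_gt0.
    have cy : cand c l A S y by rewrite /cand yS.
    apply: wp_if; rewrite guardE => gy.
      apply: wp_rset; rewrite /= r4 (reval_wcost I2 ey) -/(wcost c lam A S y).
      split=> //; first by rewrite /= e3.
      split; rewrite /= /upd ?eqxx //=; first exact: inv_rscratch.
      by rewrite costS cy gy.
    apply: wp_skip; split=> //; first by rewrite e3.
    by split=> //; rewrite r4 costS cy (negPf gy) addr0.
  move=> ncy; apply: wp_skip; split=> //; split=> //.
  by rewrite h4 costS /cand (negPf ncy) addr0.
- move=> s' [I' _ _ h4]; apply: hP => //; rewrite h4; apply: eq_bigl => y.
  by rewrite ltn_ord andbT.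
Qed.

Lemma wp_try_add (S : {set X}) N r t s v (Post : state R -> R -> Prop) :
  A \subset S -> round_inv S N r t s ->
  (forall s', round_inv (after_draw f c l lam A S r) N r t s' -> Post s' v) ->
  wp (try_add k l lam) s v Post.
Proof.
have er (s1 : state R) : round_inv S N r t s1 -> ieval s1 (scalar 1) = r by move/inv_r.
move=> AS I hP; have en : ieval s size_e = #|X| by apply: inv_n I.
apply: wp_if; rewrite beval_and beval_ilt (er _ I) en.
  case/andP=> rn; set x : X := enum_val (Ordinal rn).
  have xr : enum_rank x = r :> nat by rewrite /x enum_valK.
  have ex : ieval s (scalar 1) = enum_rank x by rewrite (er _ I) xr.
  rewrite !beval_and (beval_not_in I ex) (beval_small l I ex) (beval_fits I ex).
  case/and3P=> xS xsm xfit.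
  have pk : packable c (fun=> 1) (x |: S).
    by apply/forallP=> j; rewrite big_setU1 //= -lerBrDr; apply: (forallP xfit).
  have drawE : after_draw f c l lam A S r = if chosen f c l lam A S x then x |: S else S.
    by rewrite /after_draw insubT /add_if_chosen pk andbT.
  have chE : chosen f c l lam A S x = (f S < f (x |: S)) &&
    (cost_before (cand c l A S) (marg f S) (wcost c lam A S) x < total_wgt c lam A S).
    by rewrite /chosen /greedy /cand xS [small _ _ _ _]xsm /= /marg subr_gt0.
  apply: wp_seq; apply: wp_query; rewrite (coded_set_bool (inv_S I)) /=.
  have {}I := inv_rscratch I (f S) (ltn0Sn 0).
  set s1 := rset _ _ _ _ in I *.
  have r1 : rmem s1 (k + 3) 1 = f S by rewrite /= /upd !eqxx.
  move: s1 I r1 => s1 I r1.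
  apply: wp_seq; apply: (wp_probe I (x := x)) => //; first by rewrite (inv_r I).
  move=> s2 I2 _ erm.
  have {}r1 : rmem s2 (k + 3) 1 = f S by rewrite erm.
  have r2 : rmem s2 (k + 3) 2 = f (x |: S) by rewrite erm eqxx.
  apply: wp_if; rewrite beval_rlt /= r1 r2 => vx; last first.
    by apply: wp_skip; apply: hP; rewrite drawE chE (negPf vx).
  apply: wp_seq; apply: (wp_compute_cost I2 xr r1 r2) => s3 I3 r4.
  apply: wp_if; rewrite beval_rlt (reval_total_wgt I3) /= r4 => hW; last first.
    by apply: wp_skip; apply: hP; rewrite drawE chE vx (negPf hW).
  apply: wp_seq; apply: (wp_update_weights I3 (x := x)); first by rewrite (inv_r I3).
  move=> s4 _ I4; apply: (wp_add_element I4 (x := x)) => //; first by rewrite (inv_r I4).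
  move=> s5 I5; apply: hP; rewrite drawE chE vx /total_wgt hW /=.
  apply: inv_eq I5 => j //; first by rewrite wgt_add.
  by rewrite big_setU1 //= opprD addrCA addrC.
move=> h; apply: wp_skip; apply: hP; suff -> : after_draw f c l lam A S r = S by [].
move: h; rewrite /after_draw; case: insubP => [o rn or|//].
set x : X := enum_val o; have ex : ieval s (scalar 1) = enum_rank x.
  by rewrite /= (inv_r I) /x enum_valK or.
rewrite rn !beval_and (beval_not_in I ex) (beval_small l I ex) (beval_fits I ex) /=.
rewrite /add_if_chosen; case: ifP => // /andP[/chosen_cand[xS xsm _] pk].
rewrite xS -/(small c l A x) xsm /= => /negP[]; apply/forallP=> j.
by have := forallP pk j; rewrite big_setU1 //= -lerBrDr.
Qed.

End Rounds.

(** * Uniform draws from fair coins and execution of the rounds *)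

Definition draws (n : nat) : nat := up_log 2 (n + 3).

Lemma draws_ge n : (n + 3 <= 2 ^ draws n)%N.
Proof. exact: up_logP. Qed.

Lemma draws_lt n i : (i < draws n)%N -> (2 ^ i < n + 3)%N.
Proof.
move=> h; have h1 : (1 < n + 3)%N by lia.
have /andP[h2 _] := @up_log_bounds 2 (n + 3) isT h1.
apply: leq_ltn_trans h2; rewrite leq_exp2l //; move: h; rewrite /draws; lia.
Qed.

Lemma draws_le n : (draws n <= n + 3)%N.
Proof.
case e : (draws n) => [//|m]; have := @draws_lt n m; rewrite e => /(_ (ltnSn m)).
exact: leq_ltn_trans (ltnW (ltn_expl m (isT : 1 < 2)%N)).
Qed.

(** The offset 3 in [draws] forces the power of two to be at least 4. *)
Lemma draws_quarter n : exists2 q, (0 < q)%N & (2 ^ draws n = 4 * q)%N.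
Proof.
have := draws_ge n; case: (draws n) => [|[|m]]; rewrite ?expn0 ?expn1; try lia.
by move=> _; exists (2 ^ m)%N; rewrite ?expn_gt0 // !expnS mulnA.
Qed.

Section Draw.
Variable (R : realType).

(** Mean of [V] over all numbers obtained by appending [i] bits to [r]. *)
Fixpoint binary_mean (V : nat -> R) (i r : nat) : R :=
  if i is i'.+1 then
    (binary_mean V i' (r + r + 1) + binary_mean V i' (r + r + 0)) / 2
  else V r.

Lemma binary_meanE V i r :
  binary_mean V i r = (\sum_(u < 2 ^ i) V (r * 2 ^ i + u)%N) / (2 ^ i)%:R.
Proof.
elim: i r => [|i IH] r /=; first by rewrite big_ord1 muln1 addn0 divr1.
have P0 : (2 ^ i)%:R != 0 :> R by rewrite pnatr_eq0 -lt0n expn_gt0.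
have -> : \sum_(u < 2 ^ i.+1) V (r * 2 ^ i.+1 + u)%N
   = \sum_(u < 2 ^ i) V ((r + r + 0) * 2 ^ i + u)%N
   + \sum_(u < 2 ^ i) V ((r + r + 1) * 2 ^ i + u)%N.
  rewrite expnS mul2n -addnn big_split_ord /=.
  by congr (_ + _); apply: eq_bigr => u _; congr V; rewrite !mulnDl !mulnDr; lia.
by rewrite !IH expnS natrM; field.
Qed.

End Draw.

Section Rounds.
Variables (R : realType) (X : finType) (f : {set X} -> R) (ok : pred {set X}).
Variables (k l lam : nat) (c : X -> 'I_k -> R).

Let M := (#|X| + 3)%N.
Local Notation wp := (wp f ok M).
Local Notation N := (2 ^ draws #|X|)%N.

Lemma wp_draw S D w rem cp g best N0 r0 t s v (V : nat -> R)
    (Post : state R -> R -> Prop) :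
  inv c S D w rem cp g best N0 r0 t s ->
  v <= (\sum_(u < N) V u) / N%:R ->
  (forall u s' v', inv c S D w rem cp g best N u t s' -> v' <= V u -> Post s' v') ->
  wp draw s v Post.
Proof.
move=> I hv hP; set m := draws _ in hv hP *.
apply: wp_seq; apply: wp_iset; rewrite /=; have {}I := inv_draws I 1.
apply: wp_seq; apply: wp_iset; rewrite /=; have {}I := inv_drawn I 0.
pose J i s v' := exists r, [/\ (i <= m)%N,
  inv c S D w rem cp g best (2 ^ (m - i)) r t s & v' <= binary_mean V i r].
apply: (wp_while (n := m) (Inv := J)).
- exact: draws_le.
- exists 0%N; rewrite subnn; split=> //; rewrite binary_meanE.
  by under eq_bigr do rewrite mul0n add0n.
- move=> i s1 v1 im [r [_ I1 h1]]; rewrite beval_ilt /= (inv_N I1) (inv_n I1).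
  split; first by apply: draws_lt; rewrite -/m; lia.
  have double_pow : (2 ^ (m - i.+1) + 2 ^ (m - i.+1) = 2 ^ (m - i))%N.
    by rewrite addnn -mul2n -expnS; congr (2 ^ _)%N; lia.
  apply: wp_seq; apply: (@wp_flip _ _ _ _ _ _ _ _ _ (binary_mean V i (r + r + 1))
    (binary_mean V i (r + r + 0))) => //=.
    have {}I1 := inv_scratch I1 1 (isT : (1 < 2 < 4)%N).
    have e2 : imem (iset s1 3 2 1) 3 2 = 1%N by [].
    move: (iset s1 3 2 1) I1 e2 => s2 I2 e2.
    apply: wp_seq; apply: wp_iset; rewrite /= (inv_r I2) e2.
    have eN := inv_N I2; have {}I2 := inv_drawn I2 (r + r + 1).
    apply: wp_iset; rewrite /= [upd _ _ _ _ 3 0]/upd /= eN.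
    have {}I2 := inv_draws I2 (2 ^ (m - i.+1) + 2 ^ (m - i.+1)).
    exists (r + r + 1)%N; split=> //; first exact: ltnW.
    by rewrite -double_pow.
  have {}I1 := inv_scratch I1 0 (isT : (1 < 2 < 4)%N).
  have e2 : imem (iset s1 3 2 0) 3 2 = 0%N by [].
  move: (iset s1 3 2 0) I1 e2 => s2 I2 e2.
  apply: wp_seq; apply: wp_iset; rewrite /= (inv_r I2) e2.
  have eN := inv_N I2; have {}I2 := inv_drawn I2 (r + r + 0).
  apply: wp_iset; rewrite /= [upd _ _ _ _ 3 0]/upd /= eN.
  have {}I2 := inv_draws I2 (2 ^ (m - i.+1) + 2 ^ (m - i.+1)).
  exists (r + r + 0)%N; split=> //; first exact: ltnW.
  by rewrite -double_pow.
- move=> s1 v1 [r [_ I1 h1]]; rewrite beval_ilt /= (inv_N I1) (inv_n I1) subn0.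
  rewrite subn0 in I1; split; last exact: hP h1.
  by rewrite -leqNgt; apply: draws_ge.
Qed.

(* The constant b lets a value promised by another guess pass through the     *)
(* rounds of this one.                                                        *)
Lemma wp_rounds (A D : {set X}) g best b N0 r0 t0 s v (Post : state R -> R -> Prop) :
  round_inv lam c A D g best A N0 r0 t0 s -> packable c (fun=> 1) A ->
  v <= b \/ v <= value f c l lam A N N./2 A ->
  (forall S N1 r t s' v', round_inv lam c A D g best S N1 r t s' ->
     packable c (fun=> 1) S -> v' <= b \/ v' <= f S -> Post s' v') ->
  wp (rounds k l lam) s v Post.
Proof.
move=> I pA hv hP; apply: wp_seq.
have N0R : N%:R != 0 :> R by rewrite pnatr_eq0 -lt0n expn_gt0.
have mean_cst (a : R) : (\sum_(u < N) a) / N%:R = a.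
  by rewrite sumr_const card_ord -[a *+ _]mulr_natr mulfK.
(* The first draw only computes [N], so the promise is constant in the drawn number. *)
apply: (wp_draw I (V := fun=> v)); first by rewrite mean_cst.
move=> r s1 v1 I1 h1; apply: wp_seq; apply: wp_iset => /=.
have {}I1 := inv_round I1 0.
have Neven : (N = N./2 + N./2)%N.
  have [q _ ->] := draws_quarter #|X|; lia.
pose J i s v' := exists S r t, [/\ round_inv lam c A D g best S N r t s,
  A \subset S, packable c (fun=> 1) S, (t + i = N./2)%N &
  v' <= b \/ v' <= value f c l lam A N i S].
apply: (wp_while (n := N./2) (Inv := J)).
- have [m e] : exists m, draws #|X| = m.+1.
    by have [q q0] := draws_quarter #|X|; case: (draws _) => [|m]; [lia | exists m].
  have := @draws_lt #|X| m; rewrite e expnS mul2n doubleK => /(_ (ltnSn m)).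
  exact: ltnW.
- exists A, r, 0%N; split=> //.
  by case: hv => hv; [left | right]; apply: le_trans h1 hv.
- move=> i s2 v2 _ [S [r2 [t2 [I2 AS pS ti h2]]]].
  rewrite beval_ilt /= (inv_t I2) (inv_N I2); split; first by lia.
  (* A promise already covered by [b] is passed on unchanged; otherwise it is split according to the
     draw. *)
  pose V u := if v2 <= b then v2 else value f c l lam A N i (after_draw f c l lam A S u).
  apply: wp_seq; apply: (wp_draw I2 (V := V)).
    case: (boolP (v2 <= b)) => hb.
      by under eq_bigr do rewrite /V hb; rewrite mean_cst.
    under eq_bigr do rewrite /V (negPf hb).
    by case: h2 => // h2; rewrite h2 in hb.
  move=> u s3 v3 I3 h3; apply: wp_seq; apply: (wp_try_add AS I3) => s4 I4.
  apply: wp_iset; rewrite /= (inv_t I4); have {}I4 := inv_round I4 (t2 + 1).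
  exists (after_draw f c l lam A S u), u, (t2 + 1)%N; split=> //; last 2 first.
  + by lia.
  + by move: h3; rewrite /V; case: ifP => hb h3; [left; apply: le_trans hb | right].
  + by case: (after_draw_cases f c l lam A S u) => [->//|[x [_ _ ->]]]; apply: subset_trans AS (subsetUr _ _).
  + by case: (after_draw_cases f c l lam A S u) => [->//|[x [_ pk ->]]].
- move=> s2 v2 [S [r2 [t2 [I2 AS pS ti h2]]]]; rewrite beval_ilt /= (inv_t I2) (inv_N I2).
  by split; [lia | apply: hP I2 pS h2].
Qed.

End Rounds.

(** * Enumeration of the cores *)

Section Guesses.
Variables (R : realType) (X : finType) (f : {set X} -> R).
Variables (k l lam : nat) (c : X -> 'I_k -> R).

Let ok : pred {set X} := packable c (fun=> 1).
Let M := (#|X| + 3)%N.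
Local Notation wp := (wp f ok M).
Local Notation N := (2 ^ draws #|X|)%N.

Fixpoint core (g : nat -> nat) (L : nat) : {set X} :=
  if L is L'.+1 then
    let S := core g L' in
    if insub (g L') is Some o then
      let x := enum_val (o : 'I_#|X|) in
      if (x \notin S) && packable c (fun=> 1) (x |: S) then x |: S else S
    else S
  else set0.

Lemma packable0 : packable c (fun=> 1) set0.
Proof. by apply/forallP=> j; rewrite big_set0. Qed.

Lemma core_packable g L : packable c (fun=> 1) (core g L).
Proof.
elim: L => [|L IH] /=; first exact: packable0.
by case: insubP => // o _ _; case: ifP => // /andP[].
Qed.

Lemma eq_core g g' L : (forall i, (i < L)%N -> g i = g' i) -> core g L = core g' L.
Proof.
elim: L => //= L IH h; rewrite IH ?h // => i iL; apply: h; exact: ltnW.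
Qed.

Lemma core_seq (s : seq X) L : (size s <= L)%N -> packable c (fun=> 1) [set y in s] ->
  (forall i j, 0 <= c i j) ->
  core (nth #|X| [seq nat_of_ord (enum_rank x) | x <- s]) L = [set y in s].
Proof.
move=> sL ps c0; rewrite -{2}(take_oversize sL).
elim: L {sL} => [|L IH] /=.
  by rewrite take0; apply/setP=> x; rewrite !inE.
rewrite IH; case: (ltnP L (size s)) => Ls; last first.
  rewrite nth_default ?size_map // insubN -?leqNgt //.
  by rewrite !take_oversize // ltnW.
case: s ps Ls {IH} => // x0 s0; set s := x0 :: s0 => ps Ls.
rewrite (nth_map x0) //; case: insubP => [o _ oE|]; last by rewrite ltn_ord.
have -> : enum_val o = nth x0 s L by rewrite (val_inj oE) enum_rankK.
set x := nth x0 s L; set S := [set y in take L s].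
have takeS : [set y in take L.+1 s] = x |: S.
  by apply/setP=> y; rewrite (take_nth x0) // !inE mem_rcons inE.
rewrite takeS; case: (boolP (x \in S)) => xS /=; first by rewrite (setUidPr _) ?sub1set.
rewrite (packable_sub c0 _ ps) // -takeS.
by apply/subsetP=> y; rewrite !in_set => /mem_take.
Qed.

Definition outer (g : nat -> nat) (D : {set X}) (s : state R) : Prop :=
  exists S w rem cp N r t, inv c S D w rem cp g (f D) N r t s.

Lemma wp_build_core L D w cp g best N0 r t s v (Post : state R -> R -> Prop) :
  inv c set0 D w (fun=> 1) cp g best N0 r t s ->
  (forall s', inv c (core g L) D w (fun j => 1 - \sum_(i in core g L) c i j)
     cp g best N0 r t s' -> Post s' v) ->
  wp (build_core k L) s v Post.
Proof.
move=> I; elim: L Post => [|L IH] Post hP.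
  apply: wp_skip; apply: hP; apply: inv_eq I => // j.
  by rewrite big_set0 subr0.
apply: wp_seq; apply: IH => s1 I1.
have en : ieval s1 size_e = #|X| := inv_n I1.
have eg : ieval s1 (IGet 4 (INat L)) = g L := inv_g I1 L.
apply: wp_if; rewrite !beval_and beval_ilt en eg.
  case/andP=> gX; have ex : ieval s1 (IGet 4 (INat L)) = enum_rank (enum_val (Ordinal gX)).
    by rewrite eg enum_valK.
  rewrite (beval_not_in I1 ex) (beval_fits I1 ex) => /andP[xS fit].
  apply: (wp_add_element I1 _ ex) => // s2 I2; apply: hP => /=.
  rewrite insubT /= (_ : Sub _ _ = Ordinal gX) // xS.
  rewrite ifT; last first.
    by apply/forallP=> j; rewrite big_setU1 //= -lerBrDr; apply: (forallP fit).
  by apply: inv_eq I2 => // j; rewrite big_setU1 //= opprD addrCA addrC.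
move=> h; apply: wp_skip; apply: hP; suff -> : core g L.+1 = core g L by [].
rewrite /=; move: h; case: insubP => // o gX oE.
have ex : ieval s1 (IGet 4 (INat L)) = enum_rank (enum_val o) by rewrite eg enum_valK.
rewrite gX (beval_not_in I1 ex) (beval_fits I1 ex) /= => h.
case: ifP => // /andP[xS pk]; case/negP: h; rewrite xS; apply/forallP=> j.
by have := forallP pk j; rewrite big_setU1 //= -lerBrDr.
Qed.

Lemma wp_keep_best S D w rem cp g N0 r t b s v (Post : state R -> R -> Prop) :
  inv c S D w rem cp g (f D) N0 r t s -> ok S -> ok D -> v <= b \/ v <= f S ->
  (forall D' s', outer g D' s' -> ok D' -> f D <= f D' -> v <= b \/ v <= f D' ->
    Post s' v) ->
  wp (keep_best k) s v Post.
Proof.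
move=> I oS oD hv hP; apply: wp_seq; apply: wp_query.
rewrite (coded_set_bool (inv_S I)) /=.
have {}I := inv_rscratch I (f S) (isT : (0 < 2)%N).
have e2 : rmem (rset s (k + 3) 2 (f S)) (k + 3) 2 = f S by rewrite /= /upd !eqxx.
move: (rset s _ _ _) I e2 => {}s I e2.
apply: wp_if; rewrite beval_rlt /= (inv_best I) e2 => fSD; last first.
  apply: wp_skip; apply: (hP D) => //.
    by exists S, w, rem, cp, N0, r, t.
  by case: hv => h; [left | right; apply: le_trans h _; rewrite leNgt].
pose copy m := [set x | if (enum_rank x < m)%N then x \in S else x \in D].
pose J m s := inv c S (copy m) w rem cp g (f D) N0 r t s /\ rmem s (k + 3) 2 = f S.
apply: wp_seq; apply: (wp_for_elements (J := J)).
- by move=> m s1 [/inv_n].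
- by move=> m s1 i [I1 h1]; split=> //; apply: inv_scratch.
- by split=> //; rewrite /copy (_ : [set x | _] = D) //; apply/setP=> x; rewrite inE.
- move=> m x s1 <- ei [I1 h1]; apply: wp_iset; rewrite /= ei (inv_S I1).
  split=> //; split=> //; have := inv_set_D I1 x (x \in S).
  rewrite (_ : (if _ then _ else _) = copy (enum_rank x).+1) //; apply/setP=> y.
  have : (enum_rank y < (enum_rank x).+1)%N = (y == x) || (enum_rank y < enum_rank x)%N.
    by rewrite ltnS leq_eqVlt (inj_eq val_inj) (inj_eq enum_rank_inj).
  rewrite /copy; case xS : (x \in S); rewrite !inE => ->; by case: eqVneq => [->|].
- move=> s1 [I1 h1]; apply: wp_rset; rewrite /= h1.
  have eS : copy #|X| = S by apply/setP=> x; rewrite inE ltn_ord.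
  rewrite eS in I1; have I2 := inv_set_best I1 (f S).
  apply: (hP S) => //; first by exists S, w, rem, cp, N0, r, t.
  exact: ltW.
Qed.

Lemma wp_attempt L g D b s v (Post : state R -> R -> Prop) :
  outer g D s -> ok D ->
  v <= b \/ v <= value f c l lam (core g L) N N./2 (core g L) ->
  (forall D' s' v', outer g D' s' -> ok D' -> f D <= f D' -> v' <= b \/ v' <= f D' ->
    Post s' v') ->
  wp (attempt k l lam L) s v Post.
Proof.
move=> [S [w [rem [cp [N0 [r [t I]]]]]]] oD hv hP; apply: wp_seq.
pose rest m := [set x in S | (m <= enum_rank x)%N].
pose J m s := inv c (rest m) D w rem cp g (f D) N0 r t s.
apply: (wp_for_elements (J := J)).
- by move=> m s1 /inv_n.
- by move=> m s1 i I1; apply: inv_scratch.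
- by rewrite /J /rest (_ : [set x in _ | _] = S) //; apply/setP=> x; rewrite inE andbT.
- move=> m x s1 <- ei I1; apply: wp_iset; rewrite /= ei.
  split=> //; have := inv_set_S I1 x false; rewrite /J.
  rewrite (_ : rest (enum_rank x) :\ x = rest (enum_rank x).+1) //; apply/setP=> y.
  rewrite !inE ltn_neqAle (inj_eq val_inj) (inj_eq enum_rank_inj) [x == y]eq_sym.
  exact: andbCA.
move=> {s I}s; rewrite /J (_ : rest _ = set0) => [I|]; last first.
  by apply/setP=> x; rewrite !inE leqNgt ltn_ord andbF.
apply: wp_seq; apply: (wp_set_remaining I (W := fun=> 1)) => // {I}s1 I.
apply: wp_seq; apply: (wp_build_core (L := L) I) => {I}s2 I.
apply: wp_seq; apply: (wp_set_caps I (W := cap c (core g L))) => [j s' e1 e2|{I}s3 I].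
  by rewrite /= e2 ?(inv_rem I) //; apply/orP; left; lia.
apply: wp_seq; apply: (wp_set_weights I (W := fun=> 1)) => // {I}s4 I.
apply: wp_seq; apply: (wp_rounds (A := core g L) (b := b) _ _ hv).
- apply: inv_eq I => // j; by rewrite /wgt setDv big_set0.
- exact: core_packable.
move=> S5 N5 r5 t5 s5 v5 I5 o5 h5.
by apply: (wp_keep_best I5 o5 oD h5) => D' s' h1 h2 h3 h4; apply: hP h1 h2 h3 h4.
Qed.

(** Only the guess [gs] must deliver its value [Vs]. The bound [b] carries promises met outside
    these loops, and [f D <= f D'] keeps anything already gained. *)
Lemma wp_all_guesses L (gs : nat -> nat) (Vs : R) m g D b s v
    (Post : state R -> R -> Prop) :
  (forall i, (gs i <= #|X|)%N) ->
  Vs = value f c l lam (core gs L) N N./2 (core gs L) ->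
  (m <= L)%N -> outer g D s -> ok D ->
  v <= b \/ (v <= Vs /\ forall i, (m <= i < L)%N -> g i = gs i) ->
  (forall g' D' s' v', outer g' D' s' -> ok D' -> f D <= f D' ->
    v' <= b \/ v' <= f D' -> (forall i, (m <= i)%N -> g' i = g i) -> Post s' v') ->
  wp (all_guesses m (attempt k l lam L)) s v Post.
Proof.
move=> gsX VsE; elim: m g D b s v Post => [|m IH] g D b s v Post mL oI oD hv hP /=.
  apply: (wp_attempt (b := b) oI oD); last by move=> D' s' v' *; apply: (hP g D').
  case: hv => [hv|[h e]]; [by left | right].
  by rewrite (@eq_core _ gs) // -VsE.
have outer_guess g1 D1 s1 x : outer g1 D1 s1 ->
    outer (fun i => if i == m then x else g1 i) D1 (iset s1 4 m x).
  by case=> S [w [rem [cp [N1 [r [t I]]]]]]; exists S, w, rem, cp, N1, r, t; apply: inv_guess.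
apply: wp_seq; apply: wp_iset => /=.
pose J i s1 v1 := exists g1 D1, [/\ outer g1 D1 s1, ok D1, f D <= f D1,
  (g1 m + i = #|X|.+1)%N /\ (forall i, (m < i)%N -> g1 i = g i) &
  (* The promise is covered from outside, already realized by the stored set, or still to be
     realized by a guess not yet passed. *)
  v1 <= b \/ v1 <= f D1 \/
    [/\ v1 <= Vs, (forall i, (m < i < L)%N -> g i = gs i) & (g1 m <= gs m)%N]].
apply: (wp_while (n := #|X|.+1) (Inv := J)).
- by rewrite /M; lia.
- exists (fun i => if i == m then 0%N else g i), D; split=> //.
  + exact: outer_guess.
  + by rewrite eqxx; split=> // i mi; rewrite gtn_eqF.
  + by case: hv => [h1|[h1 h2]]; [left | right; right; split; rewrite ?eqxx].
- move=> i s1 v1 _ [g1 [D1 [o1 ok1 f1 [gi gm] h1]]].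
  have [S [w [rem [cp [N1 [r [t I]]]]]]] := o1.
  rewrite /= (inv_g I) (inv_n I); split; first by lia.
  have next_guess g2 D2 s2 v2 : outer g2 D2 s2 -> ok D2 -> f D1 <= f D2 ->
      (forall i, (m <= i)%N -> g2 i = g1 i) ->
      v2 <= b \/ v2 <= f D2 \/
        [/\ v2 <= Vs, (forall i, (m < i < L)%N -> g i = gs i) & (g1 m < gs m)%N] ->
      wp (CISet 4 (INat m) (IAdd (IGet 4 (INat m)) (INat 1))) s2 v2 (J i).
    move=> o2 ok2 f2 g21 h2; apply: wp_iset.
    have [S2 [w2 [rem2 [cp2 [N2 [r2 [t2 I2]]]]]]] := o2.
    rewrite /= (inv_g I2) g21 //.
    exists (fun i => if i == m then (g1 m + 1)%N else g2 i), D2; rewrite eqxx; split=> //.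
    + exact: outer_guess.
    + exact: le_trans f2.
    + split; first by lia.
      by move=> i' mi; rewrite gtn_eqF // g21 ?gm // ltnW.
    + by rewrite addn1.
  apply: wp_seq.
  case: h1 => [h1|[h1|[h1 h2 h3]]].
  + apply: (IH g1 D1 b) => //; [exact: ltnW | by left|].
    move=> g2 D2 s2 v2 o2 ok2 f2 h2 g21; apply: (next_guess g2 D2) => //.
    by case: h2 => h2; [left | right; left].
  + apply: (IH g1 D1 (f D1)) => //; [exact: ltnW | by left|].
    move=> g2 D2 s2 v2 o2 ok2 f2 h2 g21; apply: (next_guess g2 D2) => //; right; left.
    by case: h2 => // h2; apply: le_trans f2.
  + move: h3; rewrite leq_eqVlt => /orP[/eqP h3|h3].
      apply: (IH g1 D1 (f D1)) => //; first exact: ltnW.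
        right; split=> // i'; rewrite leq_eqVlt => /andP[/orP[/eqP<-//|mi] iL].
        by rewrite gm // h2 // mi.
      move=> g2 D2 s2 v2 o2 ok2 f2 h4 g21; apply: (next_guess g2 D2) => //; right; left.
      by case: h4 => // h4; apply: le_trans f2.
    (* Before the right guess, [Vs] itself serves as the outside bound and the promise survives the
       iteration. *)
    apply: (IH g1 D1 Vs) => //; [exact: ltnW | by left|].
    move=> g2 D2 s2 v2 o2 ok2 f2 h4 g21; apply: (next_guess g2 D2) => //; right.
    by case: h4 => h4; [right; split | left].
- move=> s1 v1 [g1 [D1 [o1 ok1 f1 [gi gm] h1]]].
  have [S [w [rem [cp [N1 [r [t I]]]]]]] := o1.
  rewrite /= (inv_g I) (inv_n I); split; first by lia.
  apply: (hP g1 D1) => //.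
  case: h1 => [h1|[h1|[_ _ h]]]; [by left | by right |].
  by have := gsX m; lia.
Qed.

End Guesses.

(** * Assembly of the program, its running time and its expected value *)

Lemma OPT_attained (R : realType) (X : finType) (k : nat) (c : X -> 'I_k -> R)
    (f : {set X} -> R) : exists O : {set X}, [/\ packable c (fun=> 1) O,
    OPT c (fun=> 1) f <= f O & forall B, packable c (fun=> 1) B -> f B <= f O].
Proof.
have [O pO Omax] := @arg_maxP _ R _ set0 (packable c (fun=> 1)) f (packable0 c).
exists O; split=> //; apply: bigmax_le => //.
exact: Omax (packable0 c).
Qed.

Theorem theorem2 (R : realType) (k : nat) (eps : R) :
  (0 < k)%N -> 0 < eps -> eps < 1 / (4 * k%:R ^+ 2) ->
  exists (P : cmd) (p : {poly nat}),
  forall (X : finType) (c : X -> 'I_k -> R) (f : {set X} -> R),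
    (forall i j, 0 <= c i j) ->
    (forall A, 0 <= f A) ->
    submodular f ->
    let T : nat := p.[#|X|] in
    let C : 'I_k -> R := fun=> 1 in
    (forall w : T.-tuple bool,
        halted (run f c P w) /\ packable c C (output X (run f c P w))) /\
    (1 / 4 - 2 * eps) * OPT c C f
      <= coin_expectation (fun w : T.-tuple bool => f (output X (run f c P w))).
Proof.
move=> k0 eps0 _; pose lam := (768 * k)%N; pose l := (2 * lam)%N; pose L := (64 * k * l)%N.
have [p pE] := cost_poly 3 (program k l lam L).
exists (program k l lam L), p => X c f c0 f0 fsub T C.
have [O [pO OPTO Omax]] := OPT_attained c f.
have [q q0 Nq] := draws_quarter #|X|.
have Xq : (#|X| <= 4 * q)%N by have := draws_ge #|X|; lia.
have [s [sL ps hs]] := value_ge_quarter c0 f0 fsub k0 erefl q0 Xq pO Omax.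
pose gs := nth #|X| [seq nat_of_ord (enum_rank x) | x <- s].
have gsX i : (gs i <= #|X|)%N.
  rewrite /gs; case: (ltnP i (size s)) => h; last by rewrite nth_default ?size_map.
  case: s h {sL ps hs gs} => // x0 s h; rewrite (nth_map x0) //; exact: ltnW.
have coreE : core c gs L = [set y in s] by apply: core_seq.
have g : good f (packable c C) T (f O / 4) ([:: program k l lam L], input c).
  rewrite /T pE -[cost _ _]addn0.
  suff w : wp f (packable c C) (#|X| + 3) (program k l lam L) (input c) (f O / 4)
      (fun s' v' => packable c C (coded_set X s' 1) /\ v' <= f (coded_set X s' 1)).
    by apply: w => s' v' [h1 h2]; apply: good_halt.
  apply: wp_seq; apply: wp_query.
  have e0 : coded_set X (input c) 1 = set0 by apply/setP=> x; rewrite !inE.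
  rewrite e0 /=; apply: (@wp_all_guesses _ _ f k l lam c L gs _ L (fun=> 0%N) set0 (f set0)
    _ _ _ gsX erefl (leqnn L)).
  - have no_column m : (k <= m)%N -> insub m = None :> option 'I_k.
      by move=> km; apply: insubN; rewrite -leqNgt.
    pose z : 'I_k -> R := fun=> 0; exists set0, z, z, z, 0%N, 0%N, 0%N.
    apply: inv_set_best (f set0) => //; split=> //= [x|x|x j|j|j|j].
    + by rewrite inE.
    + by rewrite inE.
    + by rewrite valK valK enum_rankK.
    + by rewrite no_column.
    + by rewrite no_column ?leq_addr.
    + by rewrite no_column ?leq_addr.
  - exact: packable0.
  (* With all [L] cells still to be enumerated, agreement with [gs] is required on an empty
     range. *)
  - right; split; last by move=> i; rewrite ltnNge andbC andNb.
    rewrite coreE Nq (_ : (4 * q)./2 = (2 * q)%N) //.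
    by rewrite (_ : 4 * q = (2 * q).*2)%N ?doubleK // -mul2n mulnA.
  - move=> g' D' s' v' [S [w [rem [cp [N1 [r [t I]]]]]]] okD' fD' h _.
    by rewrite (coded_set_bool (inv_D I)); split=> //; case: h => // h; apply: le_trans fD'.
have [hh hE] := good_sound g; split=> //.
apply: le_trans hE; apply: le_trans (_ : f O * (1 / 4) <= _); last by lra.
have OPT0 : 0 <= OPT c C f.
  by apply: le_trans (f0 set0) _; apply: bigmax_ge_id.
apply: le_trans (_ : (1 / 4) * OPT c C f <= _).
  by apply: ler_wpM2r => //; lra.
by rewrite mulrC; apply: ler_wpM2r => //; lra.
Qed.
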